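(* Let $p>2$ be a prime, $\mathbf{F}$ a field of characteristic $p$, $M=(c_{ij})\in\mathbf{F}^{2\times3}$, and let $V_M$ be the associated three-dimensional representation of $G=(\mathbf{Z}/p)^3=\langle e_1,e_2,e_3\rangle$, so that $G$ acts on $\mathbf{F}[V_M]=\mathbf{F}[x,y,z]$ by algebra automorphisms with $x\cdot e_i=x$, $y\cdot e_i=y+c_{1i}x$, $z\cdot e_i=z+2c_{1i}y+(c_{1i}^2+c_{2i})x$ for $i=1,2,3$. Let $\overline\gamma_{ijk}$, $\overline f_1,\overline f_3$, $N_G(y)$, $N_G(z)$ be as defined in the context. If $\overline\gamma_{123}\ne0$ and $\overline\gamma_{135}=0$, then $\{x,\overline f_1,N_G(y),\overline f_3/x,N_G(z)\}$ is a SAGBI basis for $\mathbf{F}[V_M]^G$ with respect to the graded reverse lexicographic order with $x<y<z$. Furthermore, there are two relations among the generators, constructed by subducting the têtes-à-têtes $\left((\overline f_3/x)^p,\overline f_1^{\,(p^2+1)/2}\right)$ and $\left(\overline f_1^{\,p},N_G(y)^2\right)$.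
   Context: Let $\delta=y^2-xz$. Let $\overline\gamma_{ijk}\in\mathbf{F}$ be the $3\times3$ minor, on rows $i<j<k$, of the matrix whose rows $1,\ldots,5$ are $(c_{11},c_{12},c_{13})$, $(c_{21},c_{22},c_{23})$, $(c_{11}^p,c_{12}^p,c_{13}^p)$, $(c_{21}^p,c_{22}^p,c_{23}^p)$, $(c_{11}^{p^2},c_{12}^{p^2},c_{13}^{p^2})$. Define $$\overline f_1=-\overline\gamma_{123}\delta^p-\overline\gamma_{124}x^py^p-\overline\gamma_{134}\delta x^{2p-2}-\overline\gamma_{234}yx^{2p-1},$$ $$\overline f_2=\overline\gamma_{123}y^{p^2}-\overline\gamma_{125}y^px^{p^2-p}-\overline\gamma_{135}\delta x^{p^2-2}-\overline\gamma_{235}yx^{p^2-1},$$ $$\overline f_3=\frac{\overline f_1^{\,p}+\overline\gamma_{123}^{\,p-2}\overline f_2^{\,2}+2(-\overline\gamma_{123})^{(p-3)/2}\,\overline\gamma_{125}x^{p^2-p}\overline f_1^{\,(p+1)/2}}{-2x^{p^2-2}},$$ where $\overline f_3$ is a polynomial, divisible by $x$ when $\overline\gamma_{135}=0$. For $f\in\mathbf{F}[x,y,z]$, $N_G(f)$ is the product of the (distinct) elements of the $G$-orbit of $f$. A subset $\mathcal{B}$ of a subalgebra $A$ of a polynomial ring is a SAGBI basis for $A$ if the lead monomials of the elements of $\mathcal{B}$ generate, as an algebra, the lead term algebra of $A$ (the algebra spanned by the lead monomials of nonzero elements of $A$); then $\mathcal{B}$ generates $A$. A tête-à-tête is a pair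 $(b^I,b^J)$ of products of elements of $\mathcal{B}$ with the same lead monomial. To subduct a polynomial $F$ over $\mathcal{B}$ is to repeatedly subtract from it scalar multiples of products of elements of $\mathcal{B}$ having the same lead term as the current polynomial; to subduct a tête-à-tête $(b^I,b^J)$ is to subduct $b^I-cb^J$ with $c$ the scalar cancelling lead terms. For a SAGBI basis this ends at $0$ and yields an identity $b^I-cb^J-\sum_K c_K\,b^K=0$: this is the relation constructed by subducting the tête-à-tête. ''There are two relations'' means that the ideal of all algebraic relations among the listed generators is generated by those two relations. *)

(* Defs.v *)
From HB Require Import structures.
From mathcomp Require Import all_boot all_order all_algebra.
From mathcomp Require Import ring zify.
From mathcomp Require Import mpoly.

Set Implicit Arguments.
Unset Strict Implicit.
Unset Printing Implicit Defensive.

Import GRing.Theory.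
Local Open Scope ring_scope.

(* Graded reverse lexicographic order with 'X_0 < 'X_1 < 'X_2 < ...: in equal
   degree, at the smallest variable where the exponents differ, the monomial
   with the larger exponent is the smaller one. The order built into mpoly is
   a different one. *)
Definition grevlex_lt (n : nat) (m1 m2 : 'X_{1..n}) : bool :=
  (mdeg m1 < mdeg m2)%N ||
  (mdeg m1 == mdeg m2) &&
    [exists i : 'I_n, (m2 i < m1 i)%N &&
                      [forall j : 'I_n, (j < i)%N ==> (m1 j == m2 j)]].

Section LeadTerms.
Variables (F : fieldType) (n : nat).
Implicit Types (f : {mpoly F[n]}) (S A : {mpoly F[n]} -> Prop).

(* By convention the lead monomial of 0 is 1. *)
Definition lead_mon f : 'X_{1..n} :=
  \big[(fun m1 m2 => if grevlex_lt m1 m2 then m2 else m1)/0%MM]_(m <- msupp f) m.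

Definition lead_term f : {mpoly F[n]} := f@_(lead_mon f) *: 'X_[lead_mon f].

Definition lead_monomials S : {mpoly F[n]} -> Prop :=
  fun g => exists f, [/\ S f, f != 0 & g = 'X_[lead_mon f]].

Inductive lin_span S : {mpoly F[n]} -> Prop :=
| span_zero : lin_span S 0
| span_cons (c : F) s f : S s -> lin_span S f -> lin_span S (c *: s + f).

Inductive alg_gen S : {mpoly F[n]} -> Prop :=
| alg_base f : S f -> alg_gen S f
| alg_const (c : F) : alg_gen S c%:MP
| alg_add f g : alg_gen S f -> alg_gen S g -> alg_gen S (f + g)
| alg_mul f g : alg_gen S f -> alg_gen S g -> alg_gen S (f * g).

Definition lead_term_algebra A : {mpoly F[n]} -> Prop :=
  lin_span (lead_monomials A).

Definition sagbi_basis S A : Prop :=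
  (forall f, S f -> A f) /\
  (forall f, alg_gen (lead_monomials S) f <-> lead_term_algebra A f).

Section Subduction.
Variables (k : nat) (b : k.-tuple {mpoly F[n]}).

(* Products of generators are recorded by exponent vectors: b^I is the value
   at b of the monomial 'X_[I] in k new variables. A relation among the b_i is
   a polynomial r in these variables with r \mPo b = 0. *)
Definition bprod (I : 'X_{1..k}) : {mpoly F[n]} := 'X_[I] \mPo b.

Definition tete_a_tete (I J : 'X_{1..k}) : Prop :=
  [/\ bprod I != 0, bprod J != 0 & lead_mon (bprod I) = lead_mon (bprod J)].

(* [subduces q r]: some subduction over b of the polynomial q(b) ends at 0, and
   subtracting from q the formal counterparts of its steps gives r. *)
Inductive subduces : {mpoly F[k]} -> {mpoly F[k]} -> Prop :=
| subduces_done q : q \mPo b = 0 -> subduces q q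
| subduces_step q r (c : F) (K : 'X_{1..k}) :
    q \mPo b != 0 ->
    lead_term (q \mPo b) = lead_term (c *: bprod K) ->
    subduces (q - c *: 'X_[K]) r ->
    subduces q r.

Definition tete_a_tete_relation (I J : 'X_{1..k}) (r : {mpoly F[k]}) : Prop :=
  tete_a_tete I J /\
  exists c : F, lead_term (bprod I) = lead_term (c *: bprod J) /\
                subduces ('X_[I] - c *: 'X_[J]) r.

End Subduction.
End LeadTerms.

Section Representation.
Variables (p : nat) (F : fieldType) (M : 'M[F]_(2, 3)).
Implicit Type f : {mpoly F[3]}.

Local Notation x := ('X_0 : {mpoly F[3]}).
Local Notation y := ('X_1 : {mpoly F[3]}).
Local Notation z := ('X_2 : {mpoly F[3]}).

(* Right action of the generator e_(i+1); the coefficients c_{1,i+1} and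
   c_{2,i+1} are M 0 i and M 1 i. *)
Definition act_e (i : 'I_3) f : {mpoly F[3]} :=
  f \mPo [tuple x;
                y + M 0 i *: x;
                z + (2 * M 0 i) *: y + (M 0 i ^+ 2 + M 1 i) *: x].

(* The group is (Z/p)^3; a = (a_1, a_2, a_3) acts as e_1^a_1 e_2^a_2 e_3^a_3. *)
Definition act_G f (a : 'rV['Z_p]_3) : {mpoly F[3]} :=
  iter (a 0 2) (act_e 2) (iter (a 0 1) (act_e 1) (iter (a 0 0) (act_e 0) f)).

Definition invariant_G f : Prop := forall a : 'rV['Z_p]_3, act_G f a = f.

Definition orbit_G f : seq {mpoly F[3]} :=
  undup [seq act_G f a | a <- enum {: 'rV['Z_p]_3}].

Definition norm_G f : {mpoly F[3]} := \prod_(g <- orbit_G f) g.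

Definition gamma_row (r : nat) (j : 'I_3) : F :=
  match r with
  | 1 => M 0 j
  | 2 => M 1 j
  | 3 => M 0 j ^+ p
  | 4 => M 1 j ^+ p
  | 5 => M 0 j ^+ (p ^ 2)
  | _ => 0
  end.

(* Rows are numbered from 1. *)
Definition gamma (i j k : nat) : F :=
  \det (\matrix_(r < 3, s < 3) gamma_row (nth 0%N [:: i; j; k] r) s).

Definition delta : {mpoly F[3]} := y ^+ 2 - x * z.

Definition f1 : {mpoly F[3]} :=
  - (gamma 1 2 3 *: delta ^+ p)
  - gamma 1 2 4 *: (x ^+ p * y ^+ p)
  - gamma 1 3 4 *: (delta * x ^+ (2 * p - 2))
  - gamma 2 3 4 *: (y * x ^+ (2 * p - 1)).

Definition f2 : {mpoly F[3]} :=
  gamma 1 2 3 *: y ^+ (p ^ 2)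
  - gamma 1 2 5 *: (y ^+ p * x ^+ (p ^ 2 - p))
  - gamma 1 3 5 *: (delta * x ^+ (p ^ 2 - 2))
  - gamma 2 3 5 *: (y * x ^+ (p ^ 2 - 1)).

(* Division by x^k by shifting exponents; the monomials of f that x^k does not
   divide are dropped, so this is a quotient only when x^k divides f. *)
Definition divx (k : nat) f : {mpoly F[3]} :=
  \sum_(m : 'X_{1..3 < msize f}) f@_(m + U_(0%R) *+ k) *: 'X_[m].

Definition f3_num : {mpoly F[3]} :=
  f1 ^+ p + gamma 1 2 3 ^+ (p - 2) *: f2 ^+ 2
  + (2 * (- gamma 1 2 3) ^+ ((p - 3) %/ 2) * gamma 1 2 5)
      *: (x ^+ (p ^ 2 - p) * f1 ^+ ((p + 1) %/ 2)).

Definition f3 : {mpoly F[3]} := (- 2)^-1 *: divx (p ^ 2 - 2) f3_num.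

Definition f3_over_x : {mpoly F[3]} := divx 1 f3.

Definition generators : 5.-tuple {mpoly F[3]} :=
  [tuple x; f1; norm_G y; f3_over_x; norm_G z].

Lemma divxK k f : divx k (x ^+ k * f) = f.
Proof.
have E m : (x ^+ k * f)@_(m + U_(0%R) *+ k) = f@_m.
  by rewrite mpolyXn mulrC addmC mcoeffMX.
apply/mpolyP => m; rewrite /divx.
case: (ltnP (mdeg m) (msize (x ^+ k * f))) => h.
  by rewrite (mcoeff_mpoly (fun m => (x ^+ k * f)@_(m + U_(0%R) *+ k))) // E.
have hm : m \notin msupp f.
  apply/negP => /msize_mdeg_lt; apply/negP; rewrite -leqNgt.
  case: (eqVneq f 0) => [-> | fn0]; first by rewrite msize0.
  apply: leq_trans h; rewrite mpolyXn msizeM ?msizeX ?leq_addl //.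
  by rewrite -msize_poly_eq0 msizeX.
rewrite (memN_msupp_eq0 hm) raddf_sum big1 // => i _ /=.
rewrite mcoeffZ mcoeffX; case: eqP => [e|_]; last by rewrite mulr0.
by move: h; rewrite -e leqNgt bmdeg.
Qed.

Section Divisibility.
Hypotheses (charFp : p \in [pchar F]) (p_gt2 : (2 < p)%N).

Lemma f3_num_expand : exists h : {mpoly F[3]},
  f3_num = x ^+ (p ^ 2 - 2) *
    (x * h - (2 * gamma 1 2 3 ^+ (p - 1) * gamma 1 3 5) *: y ^+ (p ^ 2 + 2)).
Proof.
have [q Dp]: exists q, p = (2 * q + 3)%N.
  have pp : prime p by case/andP: charFp.
  exists ((p - 3) %/ 2)%N; case: (even_prime pp) => [|odp]; lia.
have charP : p \in [pchar {mpoly F[3]}] by rewrite (rmorph_pchar (@mpolyC 3 F)).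
rewrite /f3_num.
have -> : ((p - 3) %/ 2 = q)%N by lia.
have -> : ((p + 1) %/ 2 = q.+2)%N by lia.
have -> : (p - 2 = (2 * q).+1)%N by lia.
have -> : (p - 1 = (2 * q).+2)%N by lia.
have E1 : exists A : {mpoly F[3]}, f1 = (- gamma 1 2 3)%:MP * y ^+ (2 * p) + x ^+ p * A.
  exists (gamma 1 2 3 *: z ^+ p - gamma 1 2 4 *: y ^+ p
          - gamma 1 3 4 *: (delta * x ^+ (p - 2)) - gamma 2 3 4 *: (y * x ^+ (p - 1))).
  rewrite /f1.
  have -> : delta ^+ p = y ^+ (2 * p) - x ^+ p * z ^+ p.
    by rewrite /delta -(pFrobenius_autE charP) rmorphB /= !pFrobenius_autE
               -exprM [(x * z) ^+ p]exprMn.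
  have -> : (2 * p - 2 = p + (p - 2))%N by lia.
  have -> : (2 * p - 1 = p + (p - 1))%N by lia.
  rewrite !exprD -!mul_mpolyC mpolyCN; ring.
case: E1 => A E1.
have E1p : f1 ^+ p = - (gamma 1 2 3 ^+ p)%:MP * y ^+ (2 * p ^ 2) + x ^+ (p ^ 2) * A ^+ p.
  rewrite E1 -(pFrobenius_autE charP) rmorphD /= !pFrobenius_autE !exprMn.
  rewrite -!exprM -mulnA -rmorphXn /= exprNn.
  have -> : (-1) ^+ p = -1 :> F by rewrite Dp -signr_odd oddD oddM.
  by rewrite mulN1r mpolyCN.
have E1q : exists C : {mpoly F[3]}, f1 ^+ q.+2 =
    ((- gamma 1 2 3) ^+ q.+2)%:MP * y ^+ (p ^ 2 + p) + x ^+ p * C.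
  have : exists C : {mpoly F[3]}, f1 ^+ q.+2 =
    ((- gamma 1 2 3)%:MP * y ^+ (2 * p)) ^+ q.+2 + x ^+ p * C.
    elim: (q.+2) => [|n [C IH]]; first by exists 0; rewrite !expr0; ring.
    exists (A * ((- gamma 1 2 3)%:MP * y ^+ (2 * p)) ^+ n + f1 * C).
    by rewrite !exprS IH {1}E1; ring: E1.
  case=> C ->; exists C; rewrite exprMn -exprM -rmorphXn /=.
  have -> : (2 * p * q.+2 = p ^ 2 + p)%N by rewrite {2 3}Dp expnS expn1; nia.
  by [].
case: E1q => C E1q.
rewrite E1p E1q /f2 {1}Dp [_ ^+ q]exprNn [_ ^+ q.+2]exprNn.
set g := gamma 1 2 3; set g5 := gamma 1 2 5; set t5 := gamma 1 3 5.
set w5 := gamma 2 3 5.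
set X := x ^+ (p ^ 2 - 2); set Q := x ^+ (p ^ 2 - p - 1).
set R := x ^+ (p ^ 2 - 2 * p + 1); set X' := x ^+ (p ^ 2 - 3).
have pp : (3 * p <= p ^ 2)%N by rewrite expnS expn1 leq_mul2r p_gt2 orbT.
have -> : x ^+ (p ^ 2) = X * x ^+ 2 by rewrite -exprD; congr (_ ^+ _); lia.
have -> : x ^+ (p ^ 2 - 1) = X * x by rewrite -exprSr; congr (_ ^+ _); lia.
have -> : x ^+ (p ^ 2 - p) = x * Q by rewrite -exprS; congr (_ ^+ _); lia.
have -> : y ^+ (2 * p ^ 2) = (y ^+ (p ^ 2)) ^+ 2 by rewrite -exprM mulnC.
have H1 : X = x * X' by rewrite -exprS; congr (_ ^+ _); lia.
have H2 : (x * Q) ^+ 2 = X * x * R.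
  by rewrite -mulrA -!exprS -exprM -exprD; congr (_ ^+ _); lia.
have H3 : x * Q * x ^+ p = X * x ^+ 2.
  by rewrite -exprS -!exprD; congr (_ ^+ _); lia.
have Hs : (((-1) ^+ q)%:MP : {mpoly F[3]}) ^+ 2 = 1.
  by rewrite -rmorphXn /= -exprM mulnC exprM sqrrN !expr1n.
exists (x * A ^+ p
  + (g ^+ (2 * q).+1)%:MP *
     (- (2 * g * w5)%:MP * y ^+ (p ^ 2) * y + (2 * g * t5)%:MP * y ^+ (p ^ 2) * z
      + (g5 ^+ 2)%:MP * y ^+ (2 * p) * R
      + (2 * g5)%:MP * y ^+ p * Q * (t5 *: delta + w5 *: (y * x))
      + X' * (t5 *: delta + w5 *: (y * x)) ^+ 2)
  + (2 * ((-1) ^+ q * g ^+ q) * g5)%:MP * x * C).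

have -> : (-1) ^+ q.+2 = (-1) ^+ q :> F by rewrite !exprS !mulN1r opprK.
have -> : ((2 * q).+2 = q + q + 2)%N by lia.
have -> : ((2 * q).+1 = q + q + 1)%N by lia.
have -> : (2 * q + 3 = q + q + 3)%N by lia.
have -> : (2 * p = p + p)%N by lia.
have -> : q.+2 = (q + 2)%N by lia.
rewrite -!mul_mpolyC !(rmorphM, rmorphN, rmorphXn, rmorph_nat) /= !exprD.
rewrite /delta.
move: Hs H1 H2 H3; rewrite !(rmorphN, rmorphXn, rmorph1) /=.
move: (g%:MP) (g5%:MP) (t5%:MP) (w5%:MP) ((-1) ^+ q) => {}g {}g5 {}t5 {}w5 s.
move: X Q R X' (x ^+ p) (y ^+ p) (y ^+ (p ^ 2)) (A ^+ p) (g ^+ q) =>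
  {}X {}Q {}R {}X' u v w a h Hs H1 H2 H3.
set B := t5 * (y ^+ 2 - x * z) + w5 * (y * x).
transitivity (X * x ^+ 2 * a
  + h ^+ 2 * g * (g5 ^+ 2 * v ^+ 2 * (x * Q) ^+ 2 + X * X * B ^+ 2
                  - 2 * g * w * X * B + 2 * g5 * v * (x * Q) * X * B)
  + 2 * h ^+ 2 * g ^+ 2 * g5 * w * v * (x * Q) * (s ^+ 2 - 1)
  + 2 * s * h * g5 * (x * Q * u) * C); first by rewrite /B; ring.
have HX : X * X = X * (x * X') by rewrite {2}H1.
by rewrite H2 H3 Hs HX /B; ring.
Qed.

Lemma two_neq0 : (- 2 : F) != 0.
Proof.
by rewrite oppr_eq0 -(dvdn_pcharf charFp) gtnNdvd.
Qed.

Lemma f3_numE : f3_num = (- 2) *: (x ^+ (p ^ 2 - 2) * f3).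
Proof.
have [h E] := f3_num_expand.
by rewrite /f3 {2}E divxK -scalerAr scalerA divff ?two_neq0 // scale1r.
Qed.

Lemma f3_over_xE : gamma 1 3 5 = 0 -> f3 = x * f3_over_x.
Proof.
move=> g0; have [h E] := f3_num_expand.
move: E; rewrite g0 mulr0 scale0r subr0 => E.
have f3E : f3 = x ^+ 1 * ((- 2)^-1 *: h).
  by rewrite /f3 E divxK expr1 scalerAr.
by rewrite /f3_over_x {2}f3E divxK f3E expr1.
Qed.

End Divisibility.
End Representation.

(* Main.v *)
(* Put d = y^2 - xz, N = N_G(y), Nz = N_G(z). In the coordinates Y = y/x and
   D = d/x^2 the group acts on F[x, 1/x][Y, D] by the translations
   (Y, D) -> (Y + a, D - b), where (a, b) runs through a group E of order p^3 that
   projects onto p^2 values of a with fibres of size p. An invariant, multiplied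
   by a power of x, can be written as sum_(i < p^2, j < p) C_ij y^i d^j with
   C_ij in the span of the x^a N^n Nz^l f1^m, m < p^2; as these C_ij are
   invariant, evaluating at the p^3 translates and interpolating shows that
   the invariant equals C_00. The equation that defines f3/x expresses f1^p through
   N^2, x and f3/x, so the exponent of f1 can be lowered below p at the cost of
   powers of f3/x below p. The products x^a N^n Nz^l f1^i (f3/x)^j with i, j < p
   have pairwise distinct lead monomials, which yields at once that they are
   linearly independent, that x can be cancelled inside their span, and hence that
   they form a basis of the invariants whose lead monomials generate the lead
   term algebra. Finally the two relations rewrite every product of generators
   into this basis, so they generate all relations. *)
Require Import Defs.
From mathcomp Require Import all_boot all_order all_algebra.
From mathcomp Require Import ring zify.
From mathcomp Require Import mpoly.

Set Implicit Arguments.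
Unset Strict Implicit.
Unset Printing Implicit Defensive.

Import Order.TTheory GRing.Theory.
Local Open Scope ring_scope.

(** * The graded reverse lexicographic order and lead monomials *)

Section Grevlex.
Variable n : nat.
Implicit Types m : 'X_{1..n}.

(** In equal degree this order is the opposite of the degree-lexicographic one built into [mpoly],
    so totality and compatibility with products can be inherited from there. *)
Lemma grevlex_ltE m1 m2 :
  grevlex_lt m1 m2 =
  (mdeg m1 < mdeg m2)%N || (mdeg m1 == mdeg m2) && (m2 < m1)%O.
Proof.
rewrite /grevlex_lt; case: (eqVneq (mdeg m1) (mdeg m2)) => //= e.
congr (_ || _); apply/existsP/(ltmcP (esym e)).
  case=> i /andP[lt_i /forallP h]; exists i => // j ltji.
  by move/implyP/(_ ltji)/eqP: (h j).
case=> i h lt_i; exists i; rewrite lt_i /=.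
by apply/forallP => j; apply/implyP => /h ->.
Qed.

Lemma grevlex_lt_irr : irreflexive (@grevlex_lt n).
Proof. by move=> m; rewrite grevlex_ltE ltnn ltxx andbF. Qed.

Lemma grevlex_lt_trans : transitive (@grevlex_lt n).
Proof.
move=> m2 m1 m3; rewrite !grevlex_ltE.
case/orP=> [l12|/andP[/eqP e12 l12]] /orP[l23|/andP[/eqP e23 l23]].
- by rewrite (ltn_trans l12 l23).
- by rewrite -e23 l12.
- by rewrite e12 l23.
- by rewrite e12 e23 eqxx (lt_trans l23 l12) orbT.
Qed.

Lemma grevlex_lt_total m1 m2 : m1 != m2 -> grevlex_lt m1 m2 || grevlex_lt m2 m1.
Proof.
by rewrite !grevlex_ltE; case: (ltngtP (mdeg m1) (mdeg m2)) => //= _; case: ltgtP.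
Qed.

Lemma grevlex_lt_add2l m m1 m2 : grevlex_lt (m + m1) (m + m2) = grevlex_lt m1 m2.
Proof. by rewrite !grevlex_ltE !mdegD ltn_add2l eqn_add2l ltmc_add2r. Qed.

Lemma grevlex_lt_wf : well_founded (@grevlex_lt n).
Proof.
(* A smaller monomial has no larger degree, so there are finitely many; [rk d m] counts the
   predecessors of m in degree below d. *)
pose rk d m := \sum_(m' : 'X_{1..n < d}) (grevlex_lt (val m') m : nat).
have rk_lt d m1 m2 : (mdeg m1 < d)%N -> grevlex_lt m1 m2 -> (rk d m1 < rk d m2)%N.
  move=> b1 lt12; rewrite /rk (bigD1 (BMultinom b1)) //=.
  rewrite [X in (_ < X)%N](bigD1 (BMultinom b1)) //=.
  rewrite grevlex_lt_irr lt12 /= ltnS; apply: leq_sum => m' _.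
  by case l1: (grevlex_lt _ m1) => //; rewrite (grevlex_lt_trans l1 lt12).
move=> m; move: {2}(mdeg m).+1 (ltnSn (mdeg m)) => d.
elim/ltn_ind: {m}(rk d m) {-2}m (erefl (rk d m)) => r IH m rE lt_d.
constructor=> m' lt'; apply: (IH (rk d m')) => //; last first.
  move: lt'; rewrite grevlex_ltE => /orP[/ltn_trans|/andP[/eqP-> _]//]; exact.
rewrite -rE; apply: rk_lt => //.
move: lt'; rewrite grevlex_ltE => /orP[/ltn_trans|/andP[/eqP-> _]//]; exact.
Qed.

(** Injectivity of [L] makes the maximum strict. It is applied to supports, with [L] the identity or
    the lead monomial of a product of generators. *)
Lemma grevlex_seq_max (T : eqType) (L : T -> 'X_{1..n}) (s : seq T) :
  {in s &, injective L} -> s != [::] ->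
  exists2 x, x \in s & {in s, forall y, y != x -> grevlex_lt (L y) (L x)}.
Proof.
elim: s => // x s IH inj _; case: (eqVneq s [::]) => [->|sn0].
  by exists x; rewrite ?mem_head // => y; rewrite inE => /eqP->; rewrite eqxx.
have [|//|u us umax] := IH; first by apply: sub_in2 inj => y; rewrite inE orbC => ->.
case: (eqVneq x u) => [->|xu].
  by exists u; rewrite ?mem_head // => y; rewrite inE => /predU1P[->|/umax//]; rewrite eqxx.
have uxs : u \in x :: s by rewrite inE us orbT.
have /grevlex_lt_total/orP[lt|lt] : L x != L u.
- by apply: contra_neq xu; apply: inj; rewrite ?mem_head.
- by exists u => // y; rewrite inE => /predU1P[->|/umax//].
exists x; rewrite ?mem_head // => y; rewrite inE => /predU1P[->|ys]; first by rewrite eqxx.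
by case: (eqVneq y u) => [->//|/(umax _ ys) lt' _]; apply: grevlex_lt_trans lt.
Qed.

End Grevlex.

Section Lead.
Variables (F : fieldType) (n : nat).
Implicit Types (f g : {mpoly F[n]}) (m : 'X_{1..n}) (c : F).

Definition below m f := {in msupp f, forall m', grevlex_lt m' m}.

(** Relational form of [lead_mon] together with the lead coefficient: it passes through products
    directly and rules out the zero polynomial. *)
Definition has_lead f m c := c != 0 /\ below m (f - c *: 'X_[m]).

Lemma belowD m f g : below m f -> below m g -> below m (f + g).
Proof. by move=> hf hg m' /msuppD_le; rewrite mem_cat => /orP[/hf|/hg]. Qed.

Lemma belowZ m c f : below m f -> below m (c *: f).
Proof. by move=> hf m' /msuppZ_le /hf. Qed.

Lemma belowN m f : below m f -> below m (- f).
Proof. by rewrite -scaleN1r; apply: belowZ. Qed.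

Lemma below0 m : below m 0.
Proof. by move=> m'; rewrite msupp0. Qed.

Lemma below_sum m (I : eqType) (r : seq I) (G : I -> {mpoly F[n]}) :
  {in r, forall i, below m (G i)} -> below m (\sum_(i <- r) G i).
Proof.
move=> h; rewrite big_seq; apply: (big_ind (below m)); last exact: h.
  exact: below0.
by move=> ? ?; apply: belowD.
Qed.

Lemma belowX m m' : below m 'X_[m'] <-> grevlex_lt m' m.
Proof.
split=> [|lt m'']; first by apply; rewrite msuppX mem_head.
by rewrite msuppX inE => /eqP->.
Qed.

Lemma below_trans m m' f : grevlex_lt m m' -> below m f -> below m' f.
Proof. by move=> lt hf m'' /hf lt'; apply: grevlex_lt_trans lt. Qed.

Lemma below_mulX m m' f : below m f -> below (m' + m) ('X_[m'] * f).
Proof.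
move=> hf m''; rewrite mulrC (perm_mem (msuppMX _ _)) => /mapP[u /hf lt ->].
by rewrite grevlex_lt_add2l.
Qed.

Lemma belowM m m' f g : below m f -> below m' g -> below (m + m') (f * g).
Proof.
move=> hf hg u /msuppM_le /allpairsP[[v w] /= [/hf lv /hg lw ->]].
apply: (@grevlex_lt_trans _ (m + w)%MM); last by rewrite grevlex_lt_add2l.
by rewrite ![(_ + w)%MM]addmC grevlex_lt_add2l.
Qed.

Lemma has_leadX m : has_lead 'X_[m] m 1.
Proof. by split; rewrite ?oner_neq0 // scale1r subrr; apply: below0. Qed.

Lemma has_leadD f g m c : has_lead f m c -> below m g -> has_lead (f + g) m c.
Proof. by case=> c0 hf hg; split=> //; rewrite addrAC; apply: belowD. Qed.

Lemma has_leadZ f m c d : d != 0 -> has_lead f m c -> has_lead (d *: f) m (d * c).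
Proof.
case: (eqVneq d 0) => // d0 _ [c0 hf]; split; first by rewrite mulf_neq0.
by rewrite -scalerA -scalerBr; apply: belowZ.
Qed.

Lemma has_lead_mulX_below f g m m' c :
  has_lead f m c -> below m' g -> below (m + m') (f * g).
Proof.
case=> _ hf hg; rewrite -[f](subrK (c *: 'X_[m])) mulrDl -scalerAl.
by apply: belowD; [apply: belowM|apply/belowZ/below_mulX].
Qed.

Lemma has_leadM f g m m' c d :
  has_lead f m c -> has_lead g m' d -> has_lead (f * g) (m + m') (c * d).
Proof.
move=> hf hg; have [c0 bf] := hf; have [d0 bg] := hg.
split; first by rewrite mulf_neq0.
rewrite mpolyXD; set A := 'X_[m]; set B := 'X_[m'].
have -> : f * g - (c * d) *: (A * B) = f * (g - d *: B) + d *: (B * (f - c *: A)).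
  rewrite !mulrBr scalerBr -!scalerAr (mulrC B f) addrA subrK.
  by rewrite scalerA mulrC (mulrC d) [B * A]mulrC mulrC.
by apply: belowD; [apply: has_lead_mulX_below hf _|rewrite addmC; apply/belowZ/below_mulX].
Qed.

Lemma has_lead_exp f m c k : has_lead f m c -> has_lead (f ^+ k) (m *+ k) (c ^+ k).
Proof.
move=> hf; elim: k => [|k IH]; first by rewrite !expr0 mulm0n -mpolyX0; apply: has_leadX.
by rewrite !exprS mulmS; apply: has_leadM.
Qed.

Lemma has_lead_prod (I : Type) (r : seq I) (G : I -> {mpoly F[n]}) m :
  (forall i, has_lead (G i) m 1) -> has_lead (\prod_(i <- r) G i) (m *+ size r) 1.
Proof.
move=> h; elim: r => [|i r IH]; first by rewrite big_nil mulm0n -mpolyX0; apply: has_leadX.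
by rewrite big_cons mulmS; have := has_leadM (h i) IH; rewrite mulr1.
Qed.

Lemma has_lead_coef f m c : has_lead f m c -> f@_m = c.
Proof.
case=> _ hf; have /memN_msupp_eq0 : m \notin msupp (f - c *: 'X_[m]).
  by apply/negP => /hf; rewrite grevlex_lt_irr.
by rewrite mcoeffB mcoeffZ mcoeffX eqxx mulr1 => /eqP; rewrite subr_eq0 => /eqP.
Qed.

Lemma has_lead_supp f m c : has_lead f m c -> m \in msupp f.
Proof. by move=> hf; rewrite mcoeff_msupp (has_lead_coef hf); case: hf. Qed.

Lemma has_lead_neq0 f m c : has_lead f m c -> f != 0.
Proof. by move/has_lead_supp; apply: contraTneq => ->; rewrite msupp0. Qed.

Lemma has_lead_max f m c m' :
  has_lead f m c -> m' \in msupp f -> m' != m -> grevlex_lt m' m.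
Proof.
case=> _ hf; rewrite !mcoeff_msupp => fm' m'm; apply: hf.
by rewrite mcoeff_msupp mcoeffB mcoeffZ mcoeffX [m == _]eq_sym (negPf m'm) mulr0 subr0.
Qed.

Lemma lead_mon_fold (r : seq 'X_{1..n}) m :
  m \in r -> {in r, forall m', m' != m -> grevlex_lt m' m} ->
  \big[(fun m1 m2 => if grevlex_lt m1 m2 then m2 else m1)/0%MM]_(m <- r) m = m.
Proof.
have lt0 m0 : m0 = 0%MM \/ grevlex_lt 0%MM m0.
  case: (eqVneq m0 0%MM) => [|m00]; [by left|right].
  by rewrite grevlex_ltE mdeg0 lt0n mdeg_eq0 m00.
elim: r => [//|u r IH]; rewrite big_cons => + lt.
case mr: (m \in r); move=> mur.
  rewrite IH //; last by move=> m' m'r; apply: lt; rewrite inE m'r orbT.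
  case: (eqVneq u m) => [->|um]; first by rewrite grevlex_lt_irr.
  by rewrite lt ?mem_head.
have /eqP um : m == u by move: mur; rewrite inE mr orbF.
subst u; have {}lt : {in r, forall m', grevlex_lt m' m}.
  move=> m' m'r; apply: lt; first by rewrite inE m'r orbT.
  by apply: contraFneq mr => <-.
(* Here m occurs only at the head of the list, so the fold over the tail gives the default 0 or a
   monomial below m. *)
set w := bigop _ _ _.
have [->|ltw] : w = 0%MM \/ grevlex_lt w m.
- rewrite /w; elim: (r) lt => [|v r' IH'] lt; first by rewrite big_nil; left.
  rewrite big_cons; case: ifP => _; last by right; apply: lt; rewrite mem_head.
  by apply: IH' => m' m'r; apply: lt; rewrite inE m'r orbT.
- case: ifP => // lt_m0; case: (lt0 m) => [m0|lt0m].
    by rewrite m0.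
  by move: (grevlex_lt_trans lt0m lt_m0); rewrite grevlex_lt_irr.
by case: ifP => // /grevlex_lt_trans/(_ ltw); rewrite grevlex_lt_irr.
Qed.

Lemma lead_monE f m c : has_lead f m c -> lead_mon f = m.
Proof.
move=> hf; apply: lead_mon_fold; first exact: has_lead_supp hf.
by move=> m' m'f; apply: has_lead_max hf m'f.
Qed.

Lemma lead_monP f : f != 0 -> has_lead f (lead_mon f) f@_(lead_mon f).
Proof.
move=> f0; have [||m mf mmax] := @grevlex_seq_max n _ id (msupp f).
- by move=> ? ? _ _.
- by rewrite msupp_eq0.
have -> : lead_mon f = m by apply: lead_mon_fold.
split; first by rewrite -mcoeff_msupp.
move=> m'; rewrite mcoeff_msupp mcoeffB mcoeffZ mcoeffX; case: (eqVneq m m') => [->|mm'].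
  by rewrite mulr1 subrr eqxx.
by rewrite mulr0 subr0 -mcoeff_msupp => m'f; apply: mmax; rewrite // eq_sym.
Qed.

Lemma lead_monM f g : f != 0 -> g != 0 -> lead_mon (f * g) = (lead_mon f + lead_mon g)%MM.
Proof. by move=> /lead_monP hf /lead_monP hg; apply: lead_monE (has_leadM hf hg). Qed.

Lemma has_lead_sub f g m c :
  has_lead f m c -> has_lead g m c -> below m (f - g).
Proof.
case=> _ hf [_ hg]; rewrite -(subrKC (c *: 'X_[m]) g) opprD addrA.
by apply: belowD => //; apply: belowN.
Qed.

End Lead.

(** * Linear spans of sets of polynomials *)

Section LinSpan.
Variables (F : fieldType) (n : nat).
Implicit Types (S : {mpoly F[n]} -> Prop) (f g : {mpoly F[n]}).

Lemma lin_spanD S f g : lin_span S f -> lin_span S g -> lin_span S (f + g).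
Proof.
move=> + Sg; elim=> [|c s f' Ss _ IH]; first by rewrite add0r.
by rewrite -addrA; apply: Defs.span_cons.
Qed.

Lemma lin_spanZ S c f : lin_span S f -> lin_span S (c *: f).
Proof.
elim=> [|d s f' Ss _ IH]; first by rewrite scaler0; apply: span_zero.
by rewrite scalerDr scalerA; apply: Defs.span_cons.
Qed.

Lemma lin_span_base S f : S f -> lin_span S f.
Proof. by move=> Sf; rewrite -[f]scale1r -[_ *: f]addr0; apply/Defs.span_cons/span_zero. Qed.

Lemma lin_spanM S f g : (forall s t, S s -> S t -> lin_span S (s * t)) ->
  lin_span S f -> lin_span S g -> lin_span S (f * g).
Proof.
move=> SM + Sg; elim=> [|c s f' Ss _ IH]; first by rewrite mul0r; apply: span_zero.
rewrite mulrDl -scalerAl; apply/lin_spanD/IH/lin_spanZ.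
elim: Sg => [|d t g' St _ IHg]; first by rewrite mulr0; apply: span_zero.
by rewrite mulrDr -scalerAr; apply/lin_spanD/IHg/lin_spanZ/SM.
Qed.

Lemma lin_span_mull S T g f :
  (forall s, S s -> lin_span T (g * s)) -> lin_span S f -> lin_span T (g * f).
Proof.
move=> h; elim=> [|c s f' Ss _ IH]; first by rewrite mulr0; apply: span_zero.
by rewrite mulrDr -scalerAr; apply/lin_spanD/IH/lin_spanZ/h.
Qed.

Lemma lin_span_sub S T f : (forall s, S s -> lin_span T s) -> lin_span S f -> lin_span T f.
Proof.
by move=> h Sf; rewrite -[f]mul1r; apply: lin_span_mull Sf => s; rewrite mul1r; apply: h.
Qed.

Lemma lin_span_full S : lin_span S 1 -> (forall i s, S s -> lin_span S ('X_i * s)) ->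
  forall f, lin_span S f.
Proof.
move=> S1 SX f; rewrite (mpolyE f).
apply: (big_ind (lin_span S)); [exact: span_zero|exact: lin_spanD|move=> m _].
apply: lin_spanZ; rewrite mpolyXE_id.
elim: (index_enum _) => [|i r IH]; first by rewrite big_nil.
rewrite big_cons; elim: (m i) => [|k IHk]; first by rewrite mul1r.
by rewrite exprS -mulrA; apply: lin_span_mull IHk => s; apply: SX.
Qed.

End LinSpan.

(** * SAGBI bases from normal forms *)

Section Sagbi.
Variables (F : fieldType) (n k : nat) (b : k.-tuple {mpoly F[n]}).
Hypothesis b_neq0 : forall i, tnth b i != 0.
Implicit Types (K : 'X_{1..k}) (P q r : {mpoly F[k]}).

Local Notation lead K := (lead_mon (bprod b K)).

Lemma bprodD K K' : bprod b (K + K') = bprod b K * bprod b K'.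
Proof. by rewrite /bprod mpolyXD rmorphM. Qed.

Lemma bprod_neq0 K : bprod b K != 0.
Proof. by rewrite /bprod comp_mpolyX; apply/prodf_neq0 => i _; rewrite expf_neq0. Qed.

Lemma lead_bprodD K K' : lead (K + K') = (lead K + lead K')%MM.
Proof. by rewrite bprodD lead_monM ?bprod_neq0. Qed.

Lemma lead_bprodMn K j : lead (K *+ j) = (lead K *+ j)%MM.
Proof.
elim: j => [|j IH]; last by rewrite !mulmS lead_bprodD IH.
rewrite !mulm0n /bprod mpolyX0 rmorph1 -mpolyX0; exact: lead_monE (has_leadX _ _).
Qed.

Lemma lead_bprodU i : lead U_(i) = lead_mon (tnth b i).
Proof. by rewrite /bprod comp_mpolyXU -tnth_nth. Qed.

Lemma lead_bprodE K : lead K = (\sum_i lead_mon (tnth b i) *+ K i)%MM.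
Proof.
rewrite {1}(multinomUE_id K).
rewrite (big_morph (fun K => lead K) lead_bprodD (id1 := 0%MM)); last first.
  by rewrite -(mulm0n 0%MM) lead_bprodMn mulm0n.
by apply: eq_bigr => i _; rewrite lead_bprodMn lead_bprodU.
Qed.

Lemma comp_mpoly_bprod P : P \mPo b = \sum_(K <- msupp P) P@_K *: bprod b K.
Proof.
by rewrite comp_mpolyEX.
Qed.

Variable nf : pred 'X_{1..k}.
Hypothesis inj_nf : {in nf &, injective (fun K => lead K)}.
Local Notation normal := (fun P => {subset msupp P <= nf}).

(** The products in [nf] have distinct lead monomials, so the largest one occurring in P cannot
    cancel. This yields both the linear independence of these products and the lead monomials of
    their combinations. *)
Lemma normal_lead P : normal P -> P != 0 ->
  exists2 K, K \in msupp P & has_lead (P \mPo b) (lead K) (P@_K * (bprod b K)@_(lead K)).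
Proof.
move=> nP P0; have [||K KP Kmax] := @grevlex_seq_max n _ (fun K => lead K) (msupp P).
- by apply: sub_in2 inj_nf => K /nP.
- by rewrite msupp_eq0.
exists K => //; rewrite comp_mpoly_bprod (bigD1_seq K) ?msupp_uniq //=.
apply: has_leadD.
  by apply: has_leadZ; [rewrite -mcoeff_msupp|apply/lead_monP/bprod_neq0].
rewrite -big_filter; apply: below_sum => K'; rewrite mem_filter => /andP[K'K /Kmax/(_ K'K) lt].
have [_ bK'] := lead_monP (bprod_neq0 K').
rewrite -[bprod b K'](subrK ((bprod b K')@_(lead K') *: 'X_[lead K'])).
by apply/belowZ/belowD; [apply: below_trans bK'|apply/belowZ/belowX].
Qed.

Lemma normal_neq0 P : normal P -> P \mPo b = 0 -> P = 0.
Proof.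
by move=> nP; apply: contra_eq => /(normal_lead nP)[K _ /has_lead_neq0].
Qed.

Section NormalForm.
Variables (Id : {mpoly F[k]} -> Prop) (mu : 'X_{1..k} -> nat).
Hypotheses (Id0 : Id 0) (IdD : forall q r, Id q -> Id r -> Id (q + r)).
Hypothesis IdZ : forall c q, Id q -> Id (c *: q).
Hypothesis Id_step : forall K, ~~ nf K -> exists c K' s,
  [/\ Id ('X_[K] - c *: 'X_[K'] - s), lead K' = lead K, (mu K' < mu K)%N
    & {in msupp s, forall K'', grevlex_lt (lead K'') (lead K)}].

(** Induction on the lead monomial and then on [mu]: a step exchanges K for some K' with the same
    lead monomial and smaller [mu], up to terms of smaller lead monomial. *)
Lemma normal_form q : exists2 P, normal P & Id (q - P).
Proof.
(* Normal forms of single monomials extend to combinations by linearity. *)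
have nf_sum (s : seq 'X_{1..k}) (G : 'X_{1..k} -> F) :
    {in s, forall K, exists2 P, normal P & Id ('X_[K] - P)} ->
    exists2 P, normal P & Id (\sum_(K <- s) G K *: 'X_[K] - P).
  elim: s => [|K s IH] h.
    by exists 0; rewrite ?big_nil ?subrr // => K; rewrite msupp0.
  have [P nP IP] : exists2 P, normal P & Id ('X_[K] - P) by apply: h; rewrite mem_head.
  have [|Q nQ IQ] := IH; first by move=> K' K's; apply: h; rewrite inE K's orbT.
  exists (G K *: P + Q); last first.
    rewrite big_cons opprD addrACA -scalerBr; apply: IdD => //; exact: IdZ.
  by move=> K' /msuppD_le; rewrite mem_cat => /orP[/msuppZ_le/nP|/nQ].
suff nfX K : exists2 P, normal P & Id ('X_[K] - P).
  by rewrite (mpolyE q); apply: nf_sum => K _.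
move: {2}(lead K) (erefl (lead K)) => m.
elim/(well_founded_ind (@grevlex_lt_wf n)): m K => m IHm K.
elim/ltn_ind: {K}(mu K) {-2}K (erefl (mu K)) => d IHd K muK leadK.
case: (boolP (nf K)) => [nfK|/Id_step[c [K' [s [Is lK' lt_mu lts]]]]].
  by exists 'X_[K]; rewrite ?subrr // => K'; rewrite msuppX inE => /eqP->.
rewrite muK in lt_mu.
have [|P nP IP] := IHd _ lt_mu K' erefl; first by rewrite lK'.
have [K'' K''s|Q nQ IQ] := nf_sum (msupp s) (fun K => s@_K).
  by apply: (IHm (lead K'')) => //; rewrite -leadK; apply: lts.
rewrite -mpolyE in IQ; exists (c *: P + Q).
  by move=> K'' /msuppD_le; rewrite mem_cat => /orP[/msuppZ_le/nP|/nQ].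
have -> : 'X_[K] - (c *: P + Q) =
    ('X_[K] - c *: 'X_[K'] - s) + (c *: ('X_[K'] - P) + (s - Q)).
  by rewrite -!mul_mpolyC; ring.
by apply: IdD => //; apply: IdD => //; apply: IdZ.
Qed.

End NormalForm.

Section Invariants.
Variable A : {mpoly F[n]} -> Prop.
Hypothesis comp_A : forall P, A (P \mPo b).
Hypothesis A_normal : forall f, A f -> exists2 P, normal P & f = P \mPo b.

Lemma A_lead f : A f -> f != 0 -> exists K, lead_mon f = lead K.
Proof.
move=> /A_normal[P nP ->] fn0; have P0 : P != 0.
  by apply: contraNneq fn0 => ->; rewrite comp_mpoly0.
by have [K _ /lead_monE->] := normal_lead nP P0; exists K.
Qed.

(** The lead monomial of an element of [A] is that of a product of generators, hence a product of
    their lead monomials. Conversely, [A] is closed under products and lead monomials multiply, so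
    the lead term algebra contains all such products. *)
Lemma sagbi_of_normal : sagbi_basis (fun f => f \in (b : seq _)) A.
Proof.
have bA f : f \in (b : seq _) -> A f.
  by move=> /tnthP[i ->]; have := comp_A 'X_i; rewrite comp_mpolyXU -tnth_nth.
split=> // f; split.
  elim=> {f} [f [g [gb g0 ->]]|c|f g _ IHf _ IHg|f g _ IHf _ IHg].
  - by apply: lin_span_base; exists g; split=> //; apply: bA.
  - rewrite -[_%:MP]mulr1 mul_mpolyC; apply/lin_spanZ/lin_span_base; exists 1; split.
    + by have := comp_A 1; rewrite rmorph1.
    + exact: oner_neq0.
    + have -> : lead_mon (1 : {mpoly F[n]}) = 0%MM.
        by rewrite -mpolyX0; apply: lead_monE (has_leadX _ _).
      by rewrite mpolyX0.
  - exact: lin_spanD.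
  apply: lin_spanM IHf IHg => _ _ [s [As s0 ->]] [t [At t0 ->]].
  apply: lin_span_base; exists (s * t); split; rewrite ?mulf_neq0 //.
    have [[P _ ->] [Q _ ->]] := (A_normal As, A_normal At).
    by rewrite -rmorphM; apply: comp_A.
  by rewrite lead_monM // mpolyXD.
elim=> {f} [|c _ f [g [Ag g0 ->]] _ IH].
  by rewrite -mpolyC0; apply: alg_const.
apply: alg_add => //; rewrite -mul_mpolyC; apply: alg_mul; first exact: alg_const.
have [K ->] := A_lead Ag g0; rewrite lead_bprodE.
have alg1 : alg_gen (lead_monomials (fun f => f \in (b : seq _))) 1.
  by rewrite -mpolyC1; apply: alg_const.
apply: (big_ind (fun m => alg_gen _ 'X_[m])).
- by rewrite mpolyX0.
- by move=> m m'; rewrite mpolyXD; apply: alg_mul.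
move=> i _; elim: (K i) => [|j IH']; first by rewrite mulm0n mpolyX0.
rewrite mulmS mpolyXD; apply: alg_mul => //; apply: alg_base.
by exists (tnth b i); split=> //; apply: mem_tnth.
Qed.

Lemma has_lead_termE (f : {mpoly F[n]}) m c : has_lead f m c -> lead_term f = c *: 'X_[m].
Proof. by move=> hf; rewrite /lead_term (lead_monE hf) (has_lead_coef hf). Qed.

Lemma lead_term_has_lead (f : {mpoly F[n]}) m c :
  c != 0 -> lead_term f = c *: 'X_[m] -> has_lead f m c.
Proof.
move=> c0 E; have f0 : f != 0.
  apply: contra_neq c0 => f0; move: E; rewrite /lead_term f0 mcoeff0 scale0r.
  by move/(congr1 (mcoeff m)); rewrite mcoeff0 mcoeffZ mcoeffX eqxx mulr1.
have hf := lead_monP f0; move: E (hf); rewrite (has_lead_termE hf) => E.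
have : (f@_(lead_mon f) *: 'X_[lead_mon f])@_m = c by rewrite E mcoeffZ mcoeffX eqxx mulr1.
rewrite mcoeffZ mcoeffX; case: eqP => [->|_]; first by rewrite mulr1 => ->.
by rewrite mulr0 => c0'; rewrite -c0' eqxx in c0.
Qed.

(** A nonzero value lies in [A], so some product of generators has its lead monomial and can be
    subtracted. The lead monomials descend in a well-founded order, and the process can only stop at
    0. *)
Lemma subduces_exists q : exists r, subduces b q r.
Proof.
move: {2}(lead_mon (q \mPo b)) (erefl (lead_mon (q \mPo b))) => m.
elim/(well_founded_ind (@grevlex_lt_wf n)): m q => m IH q lq.
case: (eqVneq (q \mPo b) 0) => [q0|qn0]; first by exists q; apply: subduces_done.
have [K lqK] := A_lead (comp_A q) qn0.
set d := (bprod b K)@_(lead K); have hK := lead_monP (bprod_neq0 K).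
have hq := lead_monP qn0; rewrite -/d in hK; have [d0 _] := hK; have [e0 _] := hq.
set e := _@__ in hq e0; pose c := e / d.
have c0 : c != 0 by rewrite mulf_neq0 ?invr_eq0.
have hcK : has_lead (c *: bprod b K) (lead_mon (q \mPo b)) e.
  by have := has_leadZ c0 hK; rewrite -lqK /c divfK.
have E : (q - c *: 'X_[K]) \mPo b = q \mPo b - c *: bprod b K.
  by rewrite comp_mpolyB comp_mpolyZ.
have bel := has_lead_sub hq hcK.
have step r : subduces b (q - c *: 'X_[K]) r -> subduces b q r.
  by apply: subduces_step => //; rewrite (has_lead_termE hcK) (has_lead_termE hq).
case: (eqVneq ((q - c *: 'X_[K]) \mPo b) 0) => [q0|q'n0].
  by exists (q - c *: 'X_[K]); apply/step/subduces_done.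
have [|r hr] := IH _ _ (q - c *: 'X_[K]) erefl; last by exists r; apply: step.
by rewrite -lq; apply: bel; rewrite -E; apply: has_lead_supp (lead_monP q'n0).
Qed.

Lemma tete_a_tete_relation_exists I J :
  lead I = lead J -> exists r, tete_a_tete_relation b I J r.
Proof.
move=> lIJ; have hI := lead_monP (bprod_neq0 I); have hJ := lead_monP (bprod_neq0 J).
have [cI0 _] := hI; have [cJ0 _] := hJ.
have [r hr] := subduces_exists ('X_[I] - ((bprod b I)@_(lead I) / (bprod b J)@_(lead J)) *: 'X_[J]).
exists r; split; first by split=> //; apply: bprod_neq0.
exists ((bprod b I)@_(lead I) / (bprod b J)@_(lead J)); split=> //.
have /has_leadZ/(_ hJ) : (bprod b I)@_(lead I) / (bprod b J)@_(lead J) != 0.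
  by rewrite mulf_neq0 ?invr_eq0.
by rewrite divfK // -lIJ => /has_lead_termE->; apply: has_lead_termE.
Qed.

(** Each product subtracted has the lead monomial of the current value, and these lead monomials
    decrease from that of q(b). *)
Lemma subduces_below q r : subduces b q r -> r \mPo b = 0 /\
  forall m, below m (q \mPo b) -> {in msupp (q - r), forall K, grevlex_lt (lead K) m}.
Proof.
elim=> {q r} [q q0|q r c K q0 E _ [r0 IH]].
  by split=> // m _ K; rewrite subrr msupp0.
split=> // m hm; have hq := lead_monP q0; have [c0 hq'] := hq.
have h : has_lead (c *: bprod b K) (lead_mon (q \mPo b)) (q \mPo b)@_(lead_mon (q \mPo b)).
  by apply: lead_term_has_lead => //; rewrite -E (has_lead_termE hq).
have cn0 : c != 0 by apply: contraTneq (has_lead_neq0 h) => ->; rewrite scale0r eqxx.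
have lK : lead_mon (q \mPo b) = lead K.
  by rewrite -(lead_monE h) (lead_monE (has_leadZ cn0 (lead_monP (bprod_neq0 K)))).
have ltm : grevlex_lt (lead_mon (q \mPo b)) m by apply/hm/(has_lead_supp hq).
move=> K'; have -> : q - r = (q - c *: 'X_[K] - r) + c *: 'X_[K] by rewrite -mul_mpolyC; ring.
move/msuppD_le; rewrite mem_cat => /orP[|/msuppZ_le]; last first.
  by rewrite msuppX inE => /eqP->; rewrite -lK.
move=> K's; apply: grevlex_lt_trans ltm; apply: IH K's.
rewrite comp_mpolyB comp_mpolyZ; exact: has_lead_sub hq h.
Qed.

(** Whatever subduction is chosen, the relation acts as a rewriting rule from I to J modulo products
    of smaller lead monomial. *)
Lemma tete_a_tete_relationP I J r : tete_a_tete_relation b I J r ->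
  r \mPo b = 0 /\ exists c s, r = 'X_[I] - c *: 'X_[J] - s /\
    {in msupp s, forall K, grevlex_lt (lead K) (lead I)}.
Proof.
case=> -[I0 J0 lIJ] [c [E /subduces_below[r0 hr]]]; split=> //.
exists c, ('X_[I] - c *: 'X_[J] - r); split; first by rewrite opprB addrC subrK.
apply: hr; rewrite comp_mpolyB comp_mpolyZ.
have hI := lead_monP I0; have [cI _] := hI.
apply: has_lead_sub hI _; apply: lead_term_has_lead => //.
Qed.

End Invariants.
End Sagbi.

(** * Interpolation in two variables *)

Section Interpolation.
Variable R : idomainType.

Lemma poly_fun_eq0 (k : nat) (c : nat -> R) (rs : seq R) :
  uniq rs -> (k <= size rs)%N -> {in rs, forall r, \sum_(i < k) c i * r ^+ i = 0} ->
  forall i, (i < k)%N -> c i = 0.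
Proof.
move=> urs szrs h i ltik; pose P := \poly_(i < k) c i.
have P0 : P = 0.
  apply/eqP; apply: contraT => P0; have := @max_poly_roots _ P rs P0.
  rewrite ltnNge (leq_trans (size_poly _ _) szrs) => /(_ _ urs); apply.
  by apply/allP => r rrs; rewrite /root horner_poly h.
by have := coef_poly k c i; rewrite ltik -/P P0 coef0.
Qed.

(* The interpolation conditions determine the polynomial in two unknowns, and
   the constant [g] satisfies them. *)
Lemma interpolation_const (k l : nat) (C : nat -> nat -> R) (g : R) (A : seq R) :
  (0 < k)%N -> (0 < l)%N -> uniq A -> (k <= size A)%N ->
  {in A, forall a, exists2 B, uniq B /\ (l <= size B)%N &
    {in B, forall b, \sum_(i < k) \sum_(j < l) C i j * a ^+ i * b ^+ j = g}} ->
  C 0 0 = g.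
Proof.
move=> k0 l0 uA szA h.
(* Subtracting g from the constant coefficient turns the interpolation of g into that of 0. *)
have sum0 m (c : nat -> R) r : (0 < m)%N ->
    \sum_(i < m) (if i == 0 :> nat then c i - g else c i) * r ^+ i =
    \sum_(i < m) c i * r ^+ i - g.
  case: m => // m _; rewrite !big_ord_recl /= expr0 !mulr1 addrAC.
  by congr (_ + _ - _); apply: eq_bigr => i _; rewrite /bump.
apply/eqP; rewrite -subr_eq0; apply/eqP.
(* For fixed a, interpolation in b isolates the terms with j = 0; a second interpolation, in a, then
   isolates [C 0 0]. *)
have E a : a \in A -> \sum_(i < k) C i 0%N * a ^+ i = g.
  move=> aA; have [B [uB szB] hB] := h _ aA.
  pose c j := \sum_(i < k) C i j * a ^+ i.
  apply/eqP; rewrite -subr_eq0; apply/eqP.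
  apply: (@poly_fun_eq0 l (fun j => if j == 0%N then c j - g else c j) B uB szB _ 0%N l0).
  move=> b bB; rewrite sum0 // -(hB _ bB) [X in _ - X]exchange_big /=.
  by rewrite -sumrB big1 // => j _; rewrite mulr_suml subrr.
apply: (@poly_fun_eq0 k (fun i => if i == 0%N then C i 0%N - g else C i 0%N) A uA szA _ 0%N k0).
by move=> a aA; rewrite (sum0 k (fun i => C i 0%N)) // E // subrr.
Qed.

End Interpolation.

(** * Substitution, determinants and small index sets *)

Lemma comp_mpolyA (R : comRingType) (n k l : nat) (f : {mpoly R[n]})
    (t : n.-tuple {mpoly R[k]}) (u : k.-tuple {mpoly R[l]}) :
  (f \mPo t) \mPo u = f \mPo [tuple of map (comp_mpoly u) t].
Proof.
rewrite (comp_mpolyEX f t) (comp_mpolyEX f [tuple of _]) raddf_sum /=.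
apply: eq_bigr => m _; rewrite comp_mpolyZ !comp_mpolyX rmorph_prod.
by congr (_ *: _); apply: eq_bigr => i _; rewrite rmorphXn /= tnth_map.
Qed.

Lemma det_mx33 (R : comRingType) (A : 'M[R]_3) : \det A =
  A 0 0 * (A 1 1 * A 2 2 - A 1 2 * A 2 1) - A 0 1 * (A 1 0 * A 2 2 - A 1 2 * A 2 0)
  + A 0 2 * (A 1 0 * A 2 1 - A 1 1 * A 2 0).
Proof.
rewrite (expand_det_row _ 0) !big_ord_recl big_ord0 /cofactor.
rewrite !(expand_det_row _ 0) !big_ord_recl !big_ord0 /cofactor.
(* Indexing the entries by natural numbers lets [ring] identify equal ordinals of different form. *)
pose a (i j : nat) := A (inord i) (inord j).
have E i j : A i j = a i j by rewrite /a !inord_val.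
rewrite !det_mx11 !mxE !E /= /bump /=; ring.
Qed.

Lemma big_ord3 (V : nmodType) (G : 'I_3 -> V) : \sum_i G i = G 0 + G 1 + G 2.
Proof.
by rewrite !big_ord_recl big_ord0 addr0 addrA; congr (_ + G _ + G _); apply/val_inj.
Qed.

Lemma natr_inj_pchar (F : fieldType) (p : nat) (charF : p \in [pchar F]) i j :
  (i < p)%N -> (j < p)%N -> i%:R = j%:R :> F -> i = j.
Proof.
wlog le_ij : i j / (i <= j)%N => [wl ip jp e|_ jp /eqP].
  by case/orP: (leq_total i j) => le_ij; [|apply/esym]; apply: wl.
rewrite eq_sym -subr_eq0 -natrB // -(dvdn_pcharf charF) => /dvdnP[[|k] e]; lia.
Qed.

Lemma prod_ord5 (R : comRingType) (G : 'I_5 -> R) :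
  \prod_i G i = G 0 * G 1 * G 2 * G 3 * G 4.
Proof.
rewrite !big_ord_recl big_ord0 mulr1 !mulrA.
by congr (_ * G _ * G _ * G _ * G _); apply/val_inj.
Qed.

Lemma ord5_cases (i : 'I_5) : [\/ i = 0, i = 1, i = 2 | i = 3 \/ i = 4].
Proof.
case: i => -[|[|[|[|[|//]]]]] h;
  [apply: Or41|apply: Or42|apply: Or43|apply: Or44; left|apply: Or44; right];
  exact/val_inj.
Qed.

(** * The group action *)

Section Representation.
Variables (p : nat) (F : fieldType) (M : 'M[F]_(2, 3)).
Hypotheses (p_gt2 : (2 < p)%N) (charF : p \in [pchar F]).
Hypotheses (gamma123 : gamma p M 1 2 3 != 0) (gamma135 : gamma p M 1 3 5 = 0).
Implicit Types (f g : {mpoly F[3]}) (v w : 'rV['Z_p]_3).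

Local Notation x := ('X_0 : {mpoly F[3]}).
Local Notation y := ('X_1 : {mpoly F[3]}).
Local Notation z := ('X_2 : {mpoly F[3]}).
Local Notation delta := (delta F).
Local Notation gamma := (gamma p M).
Local Notation f1 := (f1 p M).
Local Notation f2 := (f2 p M).
Local Notation f3x := (f3_over_x p M).
Local Notation N := (norm_G p M y).
Local Notation Nz := (norm_G p M z).

Let pp : prime p. Proof. by case/andP: charF. Qed.
Let p_gt0 : (0 < p)%N. Proof. by rewrite prime_gt0. Qed.
Let charP : p \in [pchar {mpoly F[3]}].
Proof. by rewrite (rmorph_pchar (@mpolyC 3 F)). Qed.

Definition shift_vars (a b : F) : 3.-tuple {mpoly F[3]} :=
  [tuple x; y + a *: x; z + (2 * a) *: y + (a ^+ 2 + b) *: x].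

(* In the coordinates y/x and delta/x^2 the group acts by translations, which
   are indexed here by [(a, b)]. *)
Local Notation shift a b := (comp_mpoly (shift_vars a b)).

Lemma shift_x a b : shift a b x = x.
Proof. by rewrite comp_mpolyXU. Qed.

Lemma shift_y a b : shift a b y = y + a *: x.
Proof. by rewrite comp_mpolyXU. Qed.

Lemma shift_z a b : shift a b z = z + (2 * a) *: y + (a ^+ 2 + b) *: x.
Proof. by rewrite comp_mpolyXU. Qed.

Lemma shift_delta a b : shift a b delta = delta - b *: x ^+ 2.
Proof.
rewrite /Defs.delta rmorphB rmorphXn rmorphM /= shift_x shift_y shift_z.
by rewrite -!mul_mpolyC !(rmorphM, rmorphD, rmorphXn, rmorph_nat) /=; ring.
Qed.

Lemma shift_comp a b a' b' f : shift a b (shift a' b' f) = shift (a + a') (b + b') f.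
Proof.
rewrite comp_mpolyA; congr comp_mpoly; apply/eq_from_tnth => i; rewrite tnth_map.
case: i => -[|[|[|//]]] i3; rewrite !(tnth_nth 0) /= ?shift_x //.
  by rewrite comp_mpolyD comp_mpolyZ shift_x shift_y -addrA -scalerDl.
rewrite !comp_mpolyD !comp_mpolyZ shift_x shift_y shift_z.
by rewrite -!mul_mpolyC !(rmorphM, rmorphD, rmorphXn, rmorph_nat) /=; ring.
Qed.

Lemma shift0 f : shift 0 0 f = f.
Proof.
rewrite -[RHS]comp_mpoly_id; congr comp_mpoly; apply/eq_from_tnth => i.
rewrite tnth_mktuple; case: i => -[|[|[|//]]] i3; rewrite (tnth_nth 0) /=.
- by congr 'X_[U_(_)]; apply/val_inj.
- by rewrite scale0r addr0; congr 'X_[U_(_)]; apply/val_inj.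
by rewrite mulr0 expr0n /= add0r !scale0r !addr0; congr 'X_[U_(_)]; apply/val_inj.
Qed.

(** [alpha v] and [beta v] are the parameters of the translation by which v acts. Although residues
    are lifted to natural numbers, both maps are additive because F has characteristic p. *)
Definition alpha v : F := \sum_i (v 0 i)%:R * M 0 i.
Definition beta v : F := \sum_i (v 0 i)%:R * M 1 i.

Lemma iter_act_e i k f :
  iter k (act_e M i) f = shift (k%:R * M 0 i) (k%:R * M 1 i) f.
Proof.
elim: k => [|k IH]; first by rewrite !mul0r shift0.
by rewrite iterS IH /act_e -/(shift_vars _ _) shift_comp !mulrS !mulrDl !mul1r.
Qed.

Lemma act_GE f v : act_G M f v = shift (alpha v) (beta v) f.
Proof.
rewrite /act_G !iter_act_e !shift_comp /alpha /beta !big_ord3.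
by congr (comp_mpoly (shift_vars _ _) _); rewrite addrC addrA addrAC addrC addrA.
Qed.

Let Zp_p : (Zp_trunc p).+2 = p. Proof. by rewrite Zp_cast // prime_gt1. Qed.

Lemma natr_ZpD (i j : 'Z_p) : (nat_of_ord (i + j))%:R = i%:R + j%:R :> F.
Proof.
(* The modulus of ['Z_p] is p only up to the equality [Zp_p], so it is generalised first. *)
have E q : q = p -> ((i + j)%N %% q)%:R = i%:R + j%:R :> F.
  by move=> ->; rewrite GRing.natr_mod_pchar // natrD.
exact: E Zp_p.
Qed.

Lemma alphaD v w : alpha (v + w) = alpha v + alpha w.
Proof. by rewrite -big_split; apply: eq_bigr => i _; rewrite mxE natr_ZpD mulrDl. Qed.

Lemma betaD v w : beta (v + w) = beta v + beta w.
Proof. by rewrite -big_split; apply: eq_bigr => i _; rewrite mxE natr_ZpD mulrDl. Qed.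

Lemma alpha0 : alpha 0 = 0.
Proof. by rewrite /alpha big1 // => i _; rewrite mxE mul0r. Qed.

Lemma beta0 : beta 0 = 0.
Proof. by rewrite /beta big1 // => i _; rewrite mxE mul0r. Qed.

Lemma alphaN v : alpha (- v) = - alpha v.
Proof. by apply/eqP; rewrite -addr_eq0 -alphaD addNr alpha0. Qed.

Lemma betaN v : beta (- v) = - beta v.
Proof. by apply/eqP; rewrite -addr_eq0 -betaD addNr beta0. Qed.

Lemma alphaMn v k : alpha (v *+ k) = alpha v *+ k.
Proof. by elim: k => [|k IH]; rewrite ?alpha0 // !mulrS alphaD IH. Qed.

Lemma betaMn v k : beta (v *+ k) = beta v *+ k.
Proof. by elim: k => [|k IH]; rewrite ?beta0 // !mulrS betaD IH. Qed.

Lemma act_GD f v w : act_G M (act_G M f v) w = act_G M f (v + w).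
Proof. by rewrite !act_GE shift_comp alphaD betaD addrC (addrC (beta w)). Qed.

Lemma act_G0 f : act_G M f (0 : 'rV['Z_p]_3) = f.
Proof. by rewrite act_GE alpha0 beta0 shift0. Qed.

(** A group element permutes the orbit, so it only reorders the factors. *)
Lemma invariant_norm_G f : invariant_G p M (norm_G p M f).
Proof.
move=> v; rewrite act_GE rmorph_prod /= -(big_map _ predT id) /norm_G.
apply: perm_big; apply: uniq_perm; rewrite ?undup_uniq //.
  rewrite map_inj_uniq ?undup_uniq // => g h.
  by rewrite -!act_GE => /(congr1 (fun h => act_G M h (- v))); rewrite !act_GD subrr !act_G0.
move=> g; apply/mapP/idP => [[h]|].
  rewrite !mem_undup => /mapP[w _ ->] ->; rewrite -act_GE act_GD.
  by apply: map_f; rewrite mem_enum.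
rewrite mem_undup => /mapP[w _ ->]; exists (act_G M f (w - v)).
  by rewrite mem_undup; apply: map_f; rewrite mem_enum.
by rewrite -act_GE act_GD subrK.
Qed.

(** * Minors of the matrix and faithfulness of the action *)

Lemma gammaE i j k : gamma i j k =
  let r := gamma_row p M in
  r i 0 * (r j 1 * r k 2 - r j 2 * r k 1) - r i 1 * (r j 0 * r k 2 - r j 2 * r k 0)
  + r i 2 * (r j 0 * r k 1 - r j 1 * r k 0).
Proof. by rewrite /Defs.gamma det_mx33 !mxE. Qed.

(* Expansion of a determinant with a repeated column. *)
Lemma gamma_laplace i j k l s :
  let r := gamma_row p M in
  r i s * gamma j k l - r j s * gamma i k l + r k s * gamma i j l - r l s * gamma i j k = 0.
Proof.
move=> r; rewrite !gammaE /= -/r.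
have [->|[->|->]] : s = 0 \/ s = 1 \/ s = 2; last by ring.
- by case: s => -[|[|[|//]]] h; [left|right; left|right; right]; apply/val_inj.
- by ring.
by ring.
Qed.

(** Up to sign these minors are the cofactors in the expansion of gamma_123 along its second row, so
    they cannot all vanish. *)
Lemma minor_neq0 : exists i j, M 0 i * M 0 j ^+ p != M 0 j * M 0 i ^+ p.
Proof.
case: (eqVneq (M 0 0 * M 0 1 ^+ p) (M 0 1 * M 0 0 ^+ p)) => [e01|]; last by exists 0, 1.
case: (eqVneq (M 0 0 * M 0 2 ^+ p) (M 0 2 * M 0 0 ^+ p)) => [e02|]; last by exists 0, 2.
case: (eqVneq (M 0 1 * M 0 2 ^+ p) (M 0 2 * M 0 1 ^+ p)) => [e12|]; last by exists 1, 2.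
case/eqP: gamma123; rewrite gammaE /=.
transitivity (M 1 1 * (M 0 0 * M 0 2 ^+ p - M 0 2 * M 0 0 ^+ p)
  - M 1 2 * (M 0 0 * M 0 1 ^+ p - M 0 1 * M 0 0 ^+ p)
  - M 1 0 * (M 0 1 * M 0 2 ^+ p - M 0 2 * M 0 1 ^+ p)); first by ring.
by rewrite e01 e02 e12 !subrr !mulr0 !subr0.
Qed.

(** Otherwise the Laplace relation of rows 1, 2, 3, 5 makes row 5 a multiple of row 3. Then all
    minors of these two rows vanish, and since Frobenius is injective so do those of rows 1 and 3,
    against [minor_neq0]. The lead coefficient of f3/x needs this. *)
Lemma gamma235_neq0 : gamma 2 3 5 != 0.
Proof.
apply/eqP => g0; have [i [j /eqP]] := minor_neq0; apply.
have h s : gamma 1 2 5 * M 0 s ^+ p = gamma 1 2 3 * M 0 s ^+ (p ^ 2).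
  have := gamma_laplace 1 2 3 5 s; rewrite /= g0 gamma135 !mulr0 subr0 add0r mulrC.
  by move/eqP; rewrite subr_eq0 => /eqP->; rewrite mulrC.
apply: (fmorph_inj (pFrobenius_aut charF)); rewrite /= !pFrobenius_autE !exprMn -!exprM.
rewrite !mulnn; apply: (mulfI gamma123).
by rewrite mulrCA -h [RHS]mulrCA -h; ring.
Qed.

(** As a column over F, v is killed by rows 1, 2, 3, whose determinant is gamma_123: row 3 yields
    the Frobenius image of [alpha v], as Frobenius fixes the residues. *)
Lemma shift_faithful v : alpha v = 0 -> beta v = 0 -> v = 0.
Proof.
move=> al0 be0; pose A := \matrix_(r < 3, s < 3) gamma_row p M (nth 0%N [:: 1; 2; 3]%N r) s.
pose c : 'cV[F]_3 := \col_i (v 0 i)%:R.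
have Ac : A *m c = 0.
  apply/colP => r; rewrite !mxE.
  have -> : \sum_j A r j * c j 0 = \sum_j (v 0 j)%:R * gamma_row p M (nth 0%N [:: 1; 2; 3]%N r) j.
    by apply: eq_bigr => j _; rewrite !mxE mulrC.
  case: r => -[|[|[|//]]] r3 //=.
  transitivity (pFrobenius_aut charF (alpha v)); last by rewrite al0 rmorph0.
  rewrite rmorph_sum; apply: eq_bigr => j _.
  by rewrite rmorphM /= pFrobenius_aut_nat pFrobenius_autE.
have uA : A \in unitmx by rewrite unitmxE unitfE.
have c0 : c = 0 by rewrite -[c](mulKmx uA) Ac mulmx0.
apply/rowP => i; rewrite mxE; apply/val_inj => /=.
have ltp (k : 'Z_p) : (k < p)%N by rewrite -[p in leqRHS]Zp_p.
apply: (natr_inj_pchar charF) => //.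
by move/colP/(_ i): c0; rewrite !mxE.
Qed.

(** * The translations of y/x and the orbits of y and z *)

Definition alphas : seq F := undup [seq alpha v | v <- enum {: 'rV['Z_p]_3}].

Lemma alphasP a : reflect (exists v, a = alpha v) (a \in alphas).
Proof.
rewrite mem_undup; apply: (iffP mapP) => [[v _ ->]|[v ->]]; exists v => //.
by rewrite mem_enum.
Qed.

(** The dehomogenisation of [f2] for gamma_135 = 0: an additive polynomial whose roots turn out to
    be exactly the [alphas]. *)
Definition phi : {poly F} :=
  gamma 1 2 3 *: 'X^(p ^ 2) - gamma 1 2 5 *: 'X^p - gamma 2 3 5 *: 'X.

Lemma alphaXp v : alpha v ^+ p = \sum_i (v 0 i)%:R * M 0 i ^+ p.
Proof.
rewrite -(pFrobenius_autE charF) rmorph_sum; apply: eq_bigr => j _.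
by rewrite rmorphM /= pFrobenius_aut_nat pFrobenius_autE.
Qed.

Lemma alphaXpp v : alpha v ^+ (p ^ 2) = \sum_i (v 0 i)%:R * M 0 i ^+ (p ^ 2).
Proof.
rewrite -mulnn exprM alphaXp -(pFrobenius_autE charF) rmorph_sum; apply: eq_bigr => j _.
by rewrite rmorphM /= pFrobenius_aut_nat pFrobenius_autE -exprM.
Qed.

(** The powers of [alpha v] are combinations of the entries of rows 1, 3 and 5 with the same
    coefficients, so the Laplace relation of rows 1, 2, 3, 5 applies column by column; its row 2
    term vanishes with gamma_135. *)
Lemma root_phi v : root phi (alpha v).
Proof.
rewrite /root /phi !hornerE alphaXp alphaXpp /alpha !mulr_sumr -!sumrB.
rewrite big1 // => i _; have := gamma_laplace 1 2 3 5 i; rewrite /= gamma135 mulr0 subr0.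
move=> E; rewrite -[RHS](mulr0 (- (v 0 i)%:R)) -E; ring.
Qed.

Lemma size_phi : size phi = (p ^ 2).+1.
Proof.
have lt1 : (1 < p ^ 2)%N by rewrite -{1}(expn0 p) ltn_exp2l ?prime_gt1.
have ltp : (p < p ^ 2)%N by rewrite -{1}(expn1 p) ltn_exp2l ?prime_gt1.
rewrite /phi -addrA size_polyDl size_scale ?size_polyXn //.
rewrite -opprD size_polyN (leq_ltn_trans (size_polyD _ _)) // gtn_max.
by rewrite !(leq_ltn_trans (size_scale_leq _ _)) // ?size_polyXn ?size_polyX.
Qed.

(** The roots of [phi] bound the number from above. From below, two columns with nonzero minor have
    first entries independent over the prime field. *)
Lemma size_alphas : size alphas = (p ^ 2)%N.
Proof.
apply/eqP; rewrite eqn_leq; apply/andP; split.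
  rewrite -ltnS -size_phi; apply: max_poly_roots; last exact: undup_uniq.
    by rewrite -size_poly_eq0 size_phi.
  by apply/allP => a /alphasP[v ->]; apply: root_phi.
have [i [j ij]] := minor_neq0.
pose u (st : 'I_p * 'I_p) : 'rV['Z_p]_3 := delta_mx 0 i *+ st.1 + delta_mx 0 j *+ st.2.
have alpha_delta k : alpha (delta_mx 0 k) = M 0 k.
  rewrite /alpha (bigD1 k) //= big1 ?addr0 => [|l lk].
    by rewrite mxE !eqxx /= mul1r.
  by rewrite mxE (negPf lk) andbF mul0r.
have uE st : alpha (u st) = st.1%:R * M 0 i + st.2%:R * M 0 j.
  by rewrite alphaD !alphaMn !alpha_delta !mulr_natl.
have inj : injective (fun st => alpha (u st)).
  move=> [s t] [s' t'] /= E; have := congr1 (pFrobenius_aut charF) E.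
  rewrite !uE /= in E *; rewrite !rmorphD !rmorphM /= !pFrobenius_aut_nat !pFrobenius_autE => E'.
  (* Cramer's rule for the system formed by E and its Frobenius image E', whose determinant is
     nonzero by [ij]. *)
  have Es : s%:R = s'%:R :> F.
    apply/eqP; rewrite -subr_eq0; rewrite -subr_eq0 in ij.
    rewrite -(mulIr_eq0 _ (mulIf ij)); apply/eqP.
    transitivity (M 0 j ^+ p * ((s%:R * M 0 i + t%:R * M 0 j)
        - (s'%:R * M 0 i + t'%:R * M 0 j))
      - M 0 j * ((s%:R * M 0 i ^+ p + t%:R * M 0 j ^+ p)
        - (s'%:R * M 0 i ^+ p + t'%:R * M 0 j ^+ p))); first by ring.
    by rewrite E E' !subrr !mulr0 subrr.
  have Et : t%:R = t'%:R :> F.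
    apply/eqP; rewrite -subr_eq0; rewrite -subr_eq0 in ij.
    rewrite -(mulIr_eq0 _ (mulIf ij)); apply/eqP.
    transitivity (- M 0 i ^+ p * ((s%:R * M 0 i + t%:R * M 0 j)
        - (s'%:R * M 0 i + t'%:R * M 0 j))
      + M 0 i * ((s%:R * M 0 i ^+ p + t%:R * M 0 j ^+ p)
        - (s'%:R * M 0 i ^+ p + t'%:R * M 0 j ^+ p))); first by ring.
    by rewrite E E' !subrr !mulr0 addr0.
  by congr (_, _); apply/val_inj; apply: (natr_inj_pchar charF); rewrite ?ltn_ord.
have <- : size [seq alpha (u st) | st <- enum {: 'I_p * 'I_p}] = (p ^ 2)%N.
  by rewrite size_map -cardE card_prod card_ord mulnn.
apply: uniq_leq_size => [|a /mapP[st _ ->]]; last by apply/alphasP; exists (u st).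
by rewrite map_inj_uniq ?enum_uniq.
Qed.

Lemma card_G : #|{: 'rV['Z_p]_3}| = (p ^ 3)%N.
Proof. by rewrite card_mx card_ord Zp_p mul1n. Qed.

(** The p^3 group elements share p^2 values of [alpha], so two of them agree; their difference is in
    the kernel, and faithfulness makes [beta] nonzero there. *)
Lemma alpha_kernel : exists2 v, alpha v = 0 & beta v != 0.
Proof.
have /injectivePn[v [w vw e]] : ~~ injectiveb alpha.
  apply/negP; rewrite /injectiveb /dinjectiveb => /undup_id E.
  have := size_alphas; rewrite /alphas E size_map -cardE card_G.
  by apply/eqP; rewrite gtn_eqF // ltn_exp2l // prime_gt1.
exists (v - w); first by rewrite alphaD alphaN e subrr.
apply: contraNneq vw => b0; rewrite -subr_eq0; apply/eqP/shift_faithful => //.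
by rewrite alphaD alphaN e subrr.
Qed.

Lemma norm_yE : norm_G p M y = \prod_(a <- alphas) (y + a *: x).
Proof.
rewrite /norm_G /orbit_G -(big_map (fun a => y + a *: x) predT id); congr (\big[_/_]_(_ <- _) _).
rewrite -undup_map_inj.
  by congr undup; rewrite -[RHS]map_comp; apply: eq_map => v; rewrite /= act_GE shift_y.
move=> a a' /addrI /(congr1 (mcoeff U_(0))); rewrite !mcoeffZ mcoeffX eqxx !mulr1; exact.
Qed.

(** The orbit of z is free: as 2 is invertible, the coefficient of y determines [alpha v], that of x
    then determines [beta v], and the action is faithful. *)
Lemma norm_zE : norm_G p M z = \prod_(v <- enum {: 'rV['Z_p]_3}) act_G M z v.
Proof.
rewrite /norm_G /orbit_G undup_id ?big_map // map_inj_uniq ?enum_uniq // => v w.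
rewrite !act_GE !shift_z => /eqP; rewrite -!addrA => /eqP/addrI E.
have := congr1 (mcoeff U_(1)) E; have := congr1 (mcoeff U_(0)) E.
rewrite !(mcoeffD, mcoeffZ, mcoeffX) !eqxx !eq_mnm1 /= !mulr0 !mulr1 add0r !addr0 => + /eqP.
rewrite -subr_eq0 -mulrBr mulf_eq0 -[2 == 0]oppr_eq0 (negPf (two_neq0 charF p_gt2)) subr_eq0 /=.
move=> + /eqP e; rewrite e => /eqP; rewrite add0r => /eqP /addrI e'.
apply/eqP; rewrite -subr_eq0; apply/eqP/shift_faithful.
  by rewrite alphaD alphaN e subrr.
by rewrite betaD betaN e' subrr.
Qed.

(** * Invariance of the generators *)

Let x_neq0 : x != 0. Proof. by rewrite -msize_poly_eq0 msizeX. Qed.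
Let exprDp (f g : {mpoly F[3]}) : (f + g) ^+ p = f ^+ p + g ^+ p.
Proof. by rewrite -!(pFrobenius_autE charP) rmorphD. Qed.
Let exprBp (f g : {mpoly F[3]}) : (f - g) ^+ p = f ^+ p - g ^+ p.
Proof. by rewrite -!(pFrobenius_autE charP) rmorphB. Qed.
Let exprDpp (f g : {mpoly F[3]}) : (f + g) ^+ (p ^ 2) = f ^+ (p ^ 2) + g ^+ (p ^ 2).
Proof. by rewrite -mulnn !exprM !exprDp. Qed.

Lemma act_e_invariant f : (forall i, act_e M i f = f) -> invariant_G p M f.
Proof. by move=> h v; rewrite /act_G !iter_fix. Qed.

Lemma invariant_shift f v : invariant_G p M f -> shift (alpha v) (beta v) f = f.
Proof. by move=> /(_ v); rewrite act_GE. Qed.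

Lemma shift_deltaXp a b : shift a b (delta ^+ p) = delta ^+ p - b ^+ p *: x ^+ (2 * p).
Proof. by rewrite rmorphXn /= shift_delta exprBp exprZn -exprM. Qed.

Lemma shift_yXp a b : shift a b (y ^+ p) = y ^+ p + a ^+ p *: x ^+ p.
Proof. by rewrite rmorphXn /= shift_y exprDp exprZn. Qed.

Lemma shift_yXpp a b : shift a b (y ^+ (p ^ 2)) = y ^+ (p ^ 2) + a ^+ (p ^ 2) *: x ^+ (p ^ 2).
Proof. by rewrite rmorphXn /= shift_y exprDpp exprZn. Qed.

Lemma shift_xX a b k : shift a b (x ^+ k) = x ^+ k.
Proof. by rewrite rmorphXn /= shift_x. Qed.

(** The change under each e_i is - x^(2p) times the Laplace relation of rows 1, 2, 3, 4. *)
Lemma invariant_f1 : invariant_G p M f1.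
Proof.
apply: act_e_invariant => i; rewrite /act_e -/(shift_vars _ _) /Defs.f1.
rewrite !(rmorphB, rmorphN) /= !comp_mpolyZ !rmorphM /=.
rewrite shift_deltaXp shift_yXp !shift_xX shift_delta !shift_y.
have -> : x ^+ (2 * p - 1) = x ^+ (2 * p - 2) * x by rewrite -exprSr; congr (_ ^+ _); lia.
have -> : x ^+ (2 * p) = x ^+ (2 * p - 2) * x ^+ 2 by rewrite -exprD; congr (_ ^+ _); lia.
have Ep : x ^+ p * x ^+ p = x ^+ (2 * p - 2) * x ^+ 2 by rewrite -!exprD; congr (_ ^+ _); lia.
have /(congr1 (@mpolyC 3 F)) := gamma_laplace 1 2 3 4 i => /=.
rewrite -!mul_mpolyC !(rmorphD, rmorphN, rmorphM, rmorphXn, rmorph0) /= => lap.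
apply/eqP; rewrite -subr_eq0; apply/eqP.
move: Ep lap; move: (x ^+ (2 * p - 2)) (x ^+ p) (y ^+ p) (delta ^+ p) (_%:MP ^+ p) (_%:MP ^+ p).
move=> X' Xp Yp Dp a b Ep lap.
set L := (X in X = 0) in lap.
transitivity (- (X' * x ^+ 2) * L - (gamma 1 2 4)%:MP * b * (Xp * Xp - X' * x ^+ 2)).
  by rewrite /L; ring.
by rewrite lap Ep; ring.
Qed.

(** The change under each e_i is - x^(p^2) times the Laplace relation of rows 1, 2, 3, 5, in which
    gamma_135 = 0. *)
Lemma invariant_f2 : invariant_G p M f2.
Proof.
apply: act_e_invariant => i; rewrite /act_e -/(shift_vars _ _) /Defs.f2.
rewrite gamma135 scale0r subr0 !rmorphB /= !comp_mpolyZ !rmorphM /=.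
rewrite shift_yXpp shift_yXp !shift_xX shift_y.
have le1 : (p <= p ^ 2)%N by rewrite -{1}(expn1 p) leq_exp2l ?prime_gt1.
have E1 : x ^+ p * x ^+ (p ^ 2 - p) = x ^+ (p ^ 2) by rewrite -exprD subnKC.
have E2 : x * x ^+ (p ^ 2 - 1) = x ^+ (p ^ 2) by rewrite -exprS; congr (_ ^+ _); lia.
have /(congr1 (@mpolyC 3 F)) := gamma_laplace 1 2 3 5 i => /=.
rewrite gamma135 -!mul_mpolyC !(rmorphD, rmorphN, rmorphM, rmorphXn, rmorph0) /= mulr0 subr0 => lap.
apply/eqP; rewrite -subr_eq0; apply/eqP.
set L := (X in X = 0) in lap; rewrite -E1 in E2 *.
transitivity (- (x ^+ p * x ^+ (p ^ 2 - p)) * L - (gamma 2 3 5)%:MP * (M 0 i)%:MP *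
  (x * x ^+ (p ^ 2 - 1) - x ^+ p * x ^+ (p ^ 2 - p))).
  by rewrite /L; ring.
by rewrite lap E2; ring.
Qed.

(** The numerator of f3 is built from invariants and equals - 2 x^(p^2 - 1) f3/x, where the
    invariant power of x can be cancelled. *)
Lemma invariant_f3x : invariant_G p M f3x.
Proof.
move=> v; rewrite act_GE.
have E : f3_num p M = (- 2) *: (x ^+ (p ^ 2 - 2) * (x * f3x)).
  by rewrite f3_numE // -f3_over_xE.
have inv : shift (alpha v) (beta v) (f3_num p M) = f3_num p M.
  rewrite /f3_num !rmorphD /= !comp_mpolyZ !rmorphXn /= rmorphM /= !rmorphXn /= shift_x.
  by rewrite !invariant_shift //; [apply: invariant_f2|apply: invariant_f1].
move: inv; rewrite {1}E comp_mpolyZ !rmorphM /= shift_xX shift_x {}E.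
move/(scalerI (two_neq0 charF p_gt2)).
by move/(mulfI (expf_neq0 _ x_neq0))/(mulfI x_neq0).
Qed.

(* Both sides are polynomials in y with the same lead coefficient and the same
   p^2 roots. *)
Lemma f2E : f2 = gamma 1 2 3 *: N.
Proof.
pose R := {mpoly F[3]}; pose P : {poly R} := \prod_(a <- alphas) ('X + (a *: x)%:P).
have PM : P \is monic by apply: monic_prod => a _; apply: monicXaddC.
have sP : size P = (p ^ 2).+1.
  rewrite /P (eq_bigr (fun a => 'X - (- (a *: x))%:P)) => [|a _]; last by rewrite polyCN opprK.
  by rewrite size_prod_XsubC size_alphas.
pose D : {poly R} := (gamma 1 2 3)%:MP *: ('X^(p ^ 2) - P)
  - ((gamma 1 2 5)%:MP * x ^+ (p ^ 2 - p)) *: 'X^p - ((gamma 2 3 5)%:MP * x ^+ (p ^ 2 - 1)) *: 'X.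
have lt1 : (1 < p ^ 2)%N by rewrite -{1}(expn0 p) ltn_exp2l ?prime_gt1.
have ltp : (p < p ^ 2)%N by rewrite -{1}(expn1 p) ltn_exp2l ?prime_gt1.
have D0 : D = 0.
  apply/eqP; apply: contraT => D0.
  have := @max_poly_roots _ D [seq a *: x | a <- alphas] D0.
  rewrite size_map size_alphas // => lt.
  suff: (p ^ 2 < p ^ 2)%N by rewrite ltnn.
  apply: leq_trans (lt _ _) _ => {lt}.
  - apply/allP => _ /mapP[_ /alphasP[v ->] ->]; rewrite /root /D !hornerE.
    have -> : P.[alpha v *: x] = 0.
      rewrite /P horner_prod; apply/eqP; rewrite prodf_seq_eq0; apply/hasP.
      exists (- alpha v); first by apply/alphasP; exists (- v); rewrite alphaN.
      by rewrite !hornerE scaleNr subrr.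
    have := root_phi v; rewrite /root /phi !hornerE => /eqP/(congr1 (@mpolyC 3 F)).
    rewrite -!mul_mpolyC !(rmorphD, rmorphN, rmorphM, rmorphXn, rmorph0) /= => E.
    rewrite subr0 !exprMn.
    have E1 : x ^+ (p ^ 2 - p) * x ^+ p = x ^+ (p ^ 2) by rewrite -exprD subnK // ltnW.
    have E2 : x ^+ (p ^ 2 - 1) * x = x ^+ (p ^ 2) by rewrite -exprSr; congr (_ ^+ _); lia.
    apply/eqP; rewrite -[RHS](mulr0 (x ^+ (p ^ 2))) -E; ring: E1 E2.
  - rewrite map_inj_uniq ?undup_uniq // => a b /eqP; rewrite -subr_eq0 -scalerBl scaler_eq0.
    by rewrite (negPf x_neq0) orbF subr_eq0 => /eqP.
  rewrite /D; apply: (leq_trans (size_polyD _ _)); rewrite geq_max size_polyN.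
  apply/andP; split; last by apply: leq_trans (size_scale_leq _ _) _; rewrite size_polyX.
  apply: (leq_trans (size_polyD _ _)); rewrite geq_max size_polyN; apply/andP; split.
    apply: leq_trans (size_scale_leq _ _) _; apply/leq_sizeP => j lej.
    rewrite coefB coefXn; case: (ltngtP (p ^ 2)%N j) lej => // [ltj _|<- _].
      by rewrite nth_default ?subrr // sP.
    by move/monicP: PM; rewrite lead_coefE sP /= => ->; rewrite subrr.
  by apply: leq_trans (size_scale_leq _ _) _; rewrite size_polyXn.
have := congr1 (horner^~ y) D0; rewrite /D !hornerE horner_prod norm_yE // => E.
have -> : \prod_(a <- alphas) (y + a *: x) = \prod_(a <- alphas) ('X + (a *: x)%:P).[y].
  by apply: eq_bigr => a _; rewrite !hornerE.
apply/eqP; rewrite -subr_eq0; apply/eqP; rewrite -[RHS]E /Defs.f2 gamma135.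
by rewrite -!mul_mpolyC rmorph0; ring.
Qed.

(** * Lead monomials of the generators *)

(** In equal degree the order first compares exponents of x, and the larger exponent gives the
    smaller monomial. *)
Lemma below_homog d (m : 'X_{1..3}) k f h : f \is d.-homog -> mdeg m = d -> f = x ^+ k * h ->
  (m 0%R < k)%N -> below m f.
Proof.
move=> /dhomogP hf dm fE lt m' m'f.
have lt' : (m 0%R < m' 0%R)%N.
  move: m'f; rewrite fE mpolyXn mulrC (perm_mem (msuppMX _ _)) => /mapP[u _ ->].
  by rewrite mnmDE mulmnE mnm1E eqxx mul1n; apply: leq_trans lt (leq_addr _ _).
rewrite /grevlex_lt (hf _ m'f) dm ltnn eqxx /=; apply/existsP; exists 0.
by rewrite lt'; apply/forallP => -[].
Qed.

Lemma homog_var i : ('X_i : {mpoly F[3]}) \is 1.-homog.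
Proof. by rewrite dhomogX /= mdeg1. Qed.

Lemma homog_varX i k : ('X_i ^+ k : {mpoly F[3]}) \is k.-homog.
Proof. by have := dhomogMn k (homog_var i); rewrite mul1n. Qed.

Lemma homog_delta : delta \is 2.-homog.
Proof. by rewrite rpredB ?homog_varX //; apply: (dhomogM (homog_var _) (homog_var _)). Qed.

Lemma homog_f1 : f1 \is (2 * p).-homog.
Proof.
have h i j k l : (k + l = 2 * p)%N -> ('X_i ^+ k * 'X_j ^+ l : {mpoly F[3]}) \is (2 * p).-homog.
  by move=> <-; apply: dhomogM (homog_varX _ _) (homog_varX _ _).
rewrite /Defs.f1 !rpredB ?rpredN //; apply: dhomogZ.
- exact: dhomogMn homog_delta.
- by apply: h; lia.
- have -> : (2 * p = 2 + (2 * p - 2))%N by lia.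
  by rewrite addKn; apply: dhomogM homog_delta (homog_varX _ _).
by rewrite -[y]expr1; apply: h; lia.
Qed.

Let le1 : (p * 3 <= p ^ 2)%N. Proof. by rewrite -mulnn leq_mul2l p_gt2 orbT. Qed.

Lemma homog_f2 : f2 \is (p ^ 2).-homog.
Proof.
have h i j k l : (k + l = p ^ 2)%N -> ('X_i ^+ k * 'X_j ^+ l : {mpoly F[3]}) \is (p ^ 2).-homog.
  by move=> <-; apply: dhomogM (homog_varX _ _) (homog_varX _ _).
rewrite /Defs.f2 gamma135 scale0r subr0 !rpredB //; apply: dhomogZ.
- exact: homog_varX.
- by apply: h; lia.
by rewrite -[y]expr1; apply: h; lia.
Qed.

Lemma p_odd : odd p.
Proof. by case: (even_prime pp) => // p2; move: p_gt2; rewrite p2. Qed.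

Lemma homog_f3_num : f3_num p M \is (2 * p ^ 2).-homog.
Proof.
have po := p_odd; rewrite /f3_num !rpredD ?dhomogZ //.
- have -> : (2 * p ^ 2 = 2 * p * p)%N by lia.
  exact: dhomogMn homog_f1.
- by rewrite mulnC; apply: dhomogMn homog_f2.
have -> : (2 * p ^ 2 = (p ^ 2 - p) + 2 * p * ((p + 1) %/ 2))%N.
  have [q Dp] : exists q, p = (2 * q + 1)%N by exists p./2; lia.
  have -> : ((p + 1) %/ 2 = q + 1)%N by lia.
  have E : (2 * p * (q + 1) = p * p + p)%N.
    by transitivity (p * (2 * q + 1 + 1))%N; [lia|rewrite -Dp; lia].
  by rewrite E mulnn; lia.
by apply: dhomogM (homog_varX _ _) _; apply: dhomogMn homog_f1.
Qed.

Lemma homog_f3x : f3x \is (p ^ 2 + 1).-homog.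
Proof.
apply/dhomogP => m mf3.
have : (m + U_(0%R) *+ (p ^ 2 - 1)%N)%MM \in msupp (f3_num p M).
  rewrite f3_numE // f3_over_xE // mulrA -exprSr mpolyXn.
  have -> : (p ^ 2 - 2).+1 = (p ^ 2 - 1)%N by lia.
  rewrite (perm_mem (msuppZ _ (two_neq0 charF p_gt2))) mulrC (perm_mem (msuppMX _ _)).
  by rewrite addmC; apply: map_f.
by move/dhomogP: homog_f3_num => h /h /=; rewrite mdegD mdegMn mdeg1 /=; lia.
Qed.

Lemma f1_decomp : exists A, f1 = (- gamma 1 2 3) *: y ^+ (2 * p) + x ^+ p * A.
Proof.
exists (gamma 1 2 3 *: z ^+ p - gamma 1 2 4 *: y ^+ p
        - gamma 1 3 4 *: (delta * x ^+ (p - 2)) - gamma 2 3 4 *: (y * x ^+ (p - 1))).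
rewrite /Defs.f1.
have -> : delta ^+ p = y ^+ (2 * p) - x ^+ p * z ^+ p.
  by rewrite exprBp -exprM [(x * z) ^+ p]exprMn.
have -> : (2 * p - 2 = p + (p - 2))%N by lia.
have -> : (2 * p - 1 = p + (p - 1))%N by lia.
by rewrite !exprD -!mul_mpolyC mpolyCN; ring.
Qed.

Lemma lead_f1 : has_lead f1 (U_(1%R) *+ (2 * p)%N)%MM (- gamma 1 2 3).
Proof.
split; first by rewrite oppr_eq0.
have [A E] := f1_decomp; apply: (@below_homog (2 * p) _ p _ A).
- by rewrite rpredB ?homog_f1 // dhomogZ // dhomogX /= mdegMn mdeg1 mul1n.
- by rewrite mdegMn mdeg1 mul1n.
- by rewrite E -mpolyXn addrAC subrr add0r.
by rewrite mulmnE mnm1E.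
Qed.

Lemma lead_norm_y : has_lead N (U_(1%R) *+ (p ^ 2)%N)%MM 1.
Proof.
rewrite norm_yE -size_alphas; apply: has_lead_prod => a.
apply: has_leadD (has_leadX _ _) _; apply/belowZ/belowX.
rewrite /grevlex_lt !mdeg1 eqxx /=; apply/existsP; exists 0; rewrite !mnm1E /=.
by apply/forallP => -[].
Qed.

Lemma lead_norm_z : has_lead Nz (U_(2%R) *+ (p ^ 3)%N)%MM 1.
Proof.
rewrite norm_zE // -card_G cardE; apply: has_lead_prod => v; rewrite act_GE shift_z -addrA.
apply: has_leadD (has_leadX _ _) _; apply: belowD; apply/belowZ/belowX.
  rewrite /grevlex_lt !mdeg1 eqxx /=; apply/existsP; exists 1; rewrite !mnm1E /=.
  by apply/forallP => -[[|[|[|//]]]] i //=; rewrite !mnm1E.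
rewrite /grevlex_lt !mdeg1 eqxx /=; apply/existsP; exists 0; rewrite !mnm1E /=.
by apply/forallP => -[].
Qed.

(** The terms in y^(2p^2) cancel between f1^p and f2^2, those in x^(p^2-p) y^(p^2+p) between f2^2
    and the power of f1. The lowest power of x left comes from the cross term of y^(p^2) and y
    x^(p^2-1) in f2^2; the rest is divisible by x^(p^2). *)
Lemma f3_num_tail : exists h, f3_num p M =
  x ^+ (p ^ 2 - 1) * (x * h - (2 * gamma 1 2 3 ^+ (p - 1) * gamma 2 3 5) *: y ^+ (p ^ 2 + 1)).
Proof.
have po := p_odd; have [q Dp] : exists q, p = (2 * q + 3)%N by exists ((p - 3) %/ 2)%N; lia.
have [A E1] := f1_decomp.
have E1p : f1 ^+ p = (- gamma 1 2 3) ^+ p *: y ^+ (2 * p ^ 2) + x ^+ (p ^ 2) * A ^+ p.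
  by rewrite E1 exprDp exprZn exprMn -!exprM mulnA.
have [C E1q] : exists C, f1 ^+ q.+2 = (- gamma 1 2 3) ^+ q.+2 *: y ^+ (p ^ 2 + p) + x ^+ p * C.
  have : exists C, f1 ^+ q.+2 = ((- gamma 1 2 3) *: y ^+ (2 * p)) ^+ q.+2 + x ^+ p * C.
    elim: (q.+2) => [|k [C IH]]; first by exists 0; rewrite !expr0 mulr0 addr0.
    exists (A * ((- gamma 1 2 3) *: y ^+ (2 * p)) ^+ k + f1 * C).
    by rewrite !exprS IH E1; ring.
  case=> C ->; exists C; rewrite exprZn -exprM.
  by congr (_ *: _ ^+ _ + _); rewrite -mulnn; nia.
rewrite /f3_num E1p.
have -> : ((p - 3) %/ 2 = q)%N by lia.
have -> : ((p + 1) %/ 2 = q.+2)%N by lia.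
have -> : (p - 2 = (2 * q).+1)%N by lia.
have -> : (p - 1 = (2 * q).+2)%N by lia.
rewrite E1q /Defs.f2 gamma135 scale0r subr0 {E1 E1p E1q}.
set g := gamma 1 2 3; set g5 := gamma 1 2 5; set w := gamma 2 3 5.
have -> : (- g) ^+ p = - (g ^+ q ^+ 2 * g ^+ 3).
  by rewrite exprNn -signr_odd po expr1 mulN1r -exprM -exprD; congr (- _ ^+ _); lia.
have -> : (- g) ^+ q.+2 = (-1) ^+ q * g ^+ q * g ^+ 2.
  by rewrite -addn2 exprD sqrrN (exprNn g).
have -> : (- g) ^+ q = (-1) ^+ q * g ^+ q by rewrite (exprNn g).
have -> : g ^+ (2 * q).+1 = g ^+ q ^+ 2 * g by rewrite exprSr -exprM mulnC.
have -> : g ^+ (2 * q).+2 = g ^+ q ^+ 2 * g ^+ 2 by rewrite -addn2 exprD -exprM mulnC.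
(* The exponents (p-3)/2 and (p+1)/2 differ by 2, so their two signs agree and multiply to 1. *)
have Hs : ((-1) ^+ q)%:MP ^+ 2 = 1 :> {mpoly F[3]}.
  by rewrite -rmorphXn /= -exprM mulnC exprM sqrrN !expr1n.
have -> : x ^+ (p ^ 2) = x ^+ (p ^ 2 - 1) * x by rewrite -exprSr; congr (_ ^+ _); lia.
have H1 : x ^+ (p ^ 2 - p) * x ^+ p = x ^+ (p ^ 2 - 1) * x.
  by rewrite -exprD -exprSr; congr (_ ^+ _); lia.
have H2 : x ^+ (p ^ 2 - p) ^+ 2 = x ^+ (p ^ 2 - 1) * x * x ^+ (p ^ 2 - 2 * p).
  by rewrite -exprM -exprSr -exprD; congr (_ ^+ _); lia.
have H3 : x ^+ (p ^ 2 - 1) ^+ 2 = x ^+ (p ^ 2 - 1) * x * x ^+ (p ^ 2 - 2).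
  by rewrite -exprM -exprSr -exprD; congr (_ ^+ _); lia.
have H4 : x ^+ (p ^ 2 - p) * x ^+ (p ^ 2 - 1) = x ^+ (p ^ 2 - 1) * x * x ^+ (p ^ 2 - p - 1).
  by rewrite -exprSr -!exprD; congr (_ ^+ _); lia.
have -> : y ^+ (2 * p ^ 2) = y ^+ (p ^ 2) ^+ 2 by rewrite -exprM mulnC.
rewrite !(exprD y) expr1.
exists (A ^+ p + (g ^+ q ^+ 2 * g)%:MP * ((g5 ^+ 2)%:MP * y ^+ p ^+ 2 * x ^+ (p ^ 2 - 2 * p)
    + (w ^+ 2)%:MP * y ^+ 2 * x ^+ (p ^ 2 - 2) + (2 * g5 * w)%:MP * y ^+ p * y * x ^+ (p ^ 2 - p - 1))
  + (2 * ((-1) ^+ q * g ^+ q) * g5)%:MP * C).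
rewrite -!mul_mpolyC !(rmorphN, rmorphM, rmorph_nat) /=.
rewrite ?(rmorphXn (@mpolyC 3 F) 2) ?(rmorphXn (@mpolyC 3 F) 3) /=.
move: Hs H1 H2 H3 H4; move: (x ^+ (p ^ 2 - p)) (x ^+ (p ^ 2 - 1)) (x ^+ (p ^ 2 - p - 1)) => Qp X1 Q'.
move: (x ^+ (p ^ 2 - 2)) (x ^+ (p ^ 2 - 2 * p)) (x ^+ p) (y ^+ p) (y ^+ (p ^ 2)) => X2 R xp v Y.
move: (A ^+ p) (g ^+ q)%:MP ((-1) ^+ q)%:MP (g%:MP) (g5%:MP) (w%:MP) => Ap h s g' g5' w'.
move=> Hs H1 H2 H3 H4.
(* Powers of x are grouped as in the left sides of [H1] to [H4]. *)
transitivity (- (h ^+ 2 * g' ^+ 3) * Y ^+ 2 + X1 * x * Ap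
  + h ^+ 2 * g' * (g' ^+ 2 * Y ^+ 2 + g5' ^+ 2 * v ^+ 2 * Qp ^+ 2 + w' ^+ 2 * y ^+ 2 * X1 ^+ 2
     - 2 * g' * g5' * Y * v * Qp - 2 * g' * w' * Y * y * X1 + 2 * g5' * w' * v * y * (Qp * X1))
  + 2 * s ^+ 2 * h ^+ 2 * g' ^+ 2 * g5' * Y * v * Qp + 2 * s * h * g5' * C * (Qp * xp)).
  by ring.
by rewrite Hs H1 H2 H3 H4; ring.
Qed.

Lemma f3x_decomp : exists h, f3x =
  (gamma 1 2 3 ^+ (p - 1) * gamma 2 3 5) *: y ^+ (p ^ 2 + 1) + x * h.
Proof.
have [h E] := f3_num_tail; exists ((- 2)^-1 *: h).
apply: (scalerI (two_neq0 charF p_gt2)); apply: (mulfI (expf_neq0 (p ^ 2 - 1) x_neq0)).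
have := f3_numE M charF p_gt2; rewrite f3_over_xE // E.
have -> : x ^+ (p ^ 2 - 1) = x ^+ (p ^ 2 - 2) * x by rewrite -exprSr; congr (_ ^+ _); lia.
rewrite -scalerAr mulrA scalerAr => <-; congr (_ * _).
rewrite scalerDr scalerA -scalerAr scalerA (divff (two_neq0 charF p_gt2)) scale1r addrC.
by rewrite -scaleNr !mulNr mulrA.
Qed.

Lemma lead_f3x : has_lead f3x (U_(1%R) *+ (p ^ 2 + 1)%N)%MM (gamma 1 2 3 ^+ (p - 1) * gamma 2 3 5).
Proof.
split; first by rewrite mulf_neq0 ?expf_neq0 ?gamma235_neq0.
have [h E] := f3x_decomp; apply: (@below_homog (p ^ 2 + 1) _ 1 _ h).
- by rewrite rpredB ?homog_f3x // dhomogZ // dhomogX /= mdegMn mdeg1 mul1n.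
- by rewrite mdegMn mdeg1 mul1n.
- by rewrite E -mpolyXn addrAC subrr add0r.
by rewrite mulmnE mnm1E.
Qed.

(* The defining equation of f3/x, solved for f1^p. *)
Lemma f1Xp : exists c d, f1 ^+ p = (- gamma 1 2 3 ^+ p) *: N ^+ 2
  + c *: (x ^+ (p ^ 2 - p) * f1 ^+ ((p + 1) %/ 2)) + d *: (x ^+ (p ^ 2 - 1) * f3x).
Proof.
exists (- (2 * (- gamma 1 2 3) ^+ ((p - 3) %/ 2) * gamma 1 2 5)), (- 2).
have := f3_numE M charF p_gt2; rewrite f3_over_xE // mulrA -exprSr.
have -> : (p ^ 2 - 2).+1 = (p ^ 2 - 1)%N by lia.
rewrite /f3_num f2E // exprZn scalerA -exprD subnK; last by rewrite ltnW.
by move=> <-; rewrite !scaleNr addrACA -!addrA !(addrA _ (f1 ^+ p)); ring.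
Qed.

(** * Spanning by interpolation *)

(** The definition of [f1] solved for delta^p, to lower exponents of delta below p. *)
Lemma deltaXp : exists c1 c2 c3 c4, delta ^+ p = c1 *: f1 + c2 *: (x ^+ p * y ^+ p)
  + c3 *: (x ^+ (2 * p - 2) * delta) + c4 *: (x ^+ (2 * p - 1) * y).
Proof.
pose c := (- gamma 1 2 3)^-1.
exists c, (c * gamma 1 2 4), (c * gamma 1 3 4), (c * gamma 2 3 4).
rewrite -!scalerA -!scalerDr; apply: (scalerI (a := - gamma 1 2 3)); first by rewrite oppr_eq0.
rewrite scalerA divff ?oppr_eq0 // scale1r /Defs.f1 -!mul_mpolyC mpolyCN; ring.
Qed.

(** The identity f2 = gamma_123 N solved for y^(p^2), to lower exponents of y below p^2. *)
Lemma yXpp : exists c1 c2, y ^+ (p ^ 2) =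
  N + c1 *: (x ^+ (p ^ 2 - p) * y ^+ p) + c2 *: (x ^+ (p ^ 2 - 1) * y).
Proof.
pose c := (gamma 1 2 3)^-1; exists (c * gamma 1 2 5), (c * gamma 2 3 5).
rewrite -!scalerA -addrA -scalerDr; apply: (scalerI gamma123).
rewrite [RHS]scalerDr -f2E // scalerA divff // scale1r /Defs.f2 gamma135.
by rewrite -!mul_mpolyC mpolyC0; ring.
Qed.

(** Each factor is z plus a linear form in x and y, so the product is monic in z. *)
Lemma norm_z_tail (r : seq 'rV['Z_p]_3) :
  lin_span (fun g => exists a i j, (j < size r)%N /\ g = x ^+ a * y ^+ i * z ^+ j)
    (\prod_(v <- r) act_G M z v - z ^+ size r).
Proof.
elim: r => [|v r IH]; first by rewrite big_nil subrr; apply: span_zero.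
rewrite big_cons; set P := \prod_(_ <- _) _ in IH *.
have -> : act_G M z v * P - z ^+ size (v :: r) =
    z * (P - z ^+ size r) + (2 * alpha v) *: (y * (P - z ^+ size r) + y * z ^+ size r)
    + (alpha v ^+ 2 + beta v) *: (x * (P - z ^+ size r) + x * z ^+ size r).
  by rewrite act_GE shift_z /= (exprS z) -!mul_mpolyC; ring.
apply: lin_spanD;
  [apply: lin_spanD; [|apply: lin_spanZ; apply: lin_spanD]|apply: lin_spanZ; apply: lin_spanD].
- apply: lin_span_mull IH => _ [a [i [j [ltj ->]]]]; apply: lin_span_base.
  by exists a, i, j.+1; split; rewrite ?exprS //; ring.
- apply: lin_span_mull IH => _ [a [i [j [ltj ->]]]]; apply: lin_span_base.
  by exists a, i.+1, j; split; rewrite ?exprS ?(ltnW ltj) //; [apply: ltnW|ring].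
- by apply: lin_span_base; exists 0%N, 1%N, (size r); split; rewrite // ?expr0 ?expr1 ?mul1r.
- apply: lin_span_mull IH => _ [a [i [j [ltj ->]]]]; apply: lin_span_base.
  by exists a.+1, i, j; split; rewrite ?exprS //; [apply: ltnW|ring].
by apply: lin_span_base; exists 1%N, 0%N, (size r); split; rewrite // ?expr0 ?expr1 ?mulr1.
Qed.

Definition z_reduced f := exists a i l j,
  (j < p ^ 3)%N /\ f = x ^+ a * y ^+ i * Nz ^+ l * z ^+ j.

(** A factor f1 replaces delta^p and so counts as p factors delta in the weight bounded by d. *)
Definition delta_reduced d f := exists a i l m j,
  [/\ (j < p)%N, (j + p * m <= d)%N & f = x ^+ a * y ^+ i * Nz ^+ l * f1 ^+ m * delta ^+ j].

(** The invariant coefficients of the expansion in powers of y and delta. The bound on m later keeps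
    the exponent of f3/x below p. *)
Definition coef_reduced f := exists a n l m,
  (m < p ^ 2)%N /\ f = x ^+ a * N ^+ n * Nz ^+ l * f1 ^+ m.

Definition reduced f := exists q i j,
  [/\ coef_reduced q, (i < p ^ 2)%N, (j < p)%N & f = q * y ^+ i * delta ^+ j].

(* Multiplying by x^(p^3) trades z for delta, as x z = y^2 - delta; the powers
   of delta above p - 1 are then traded for f1, and the bound on the degree in z
   becomes the bound p^2 on the exponent of f1. *)
Lemma z_reduced_full f : lin_span z_reduced f.
Proof.
apply: lin_span_full f => [|i _ [a [k [l [j [ltj ->]]]]]].
  by apply: lin_span_base; exists 0%N, 0%N, 0%N, 0%N; rewrite expn_gt0 p_gt0 !expr0 !mulr1.
have [->|[->|->]] : i = 0 \/ i = 1 \/ i = 2.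
- by case: i => -[|[|[|//]]] h; [left|right; left|right; right]; apply/val_inj.
- by apply: lin_span_base; exists a.+1, k, l, j; split; rewrite ?exprS //; ring.
- by apply: lin_span_base; exists a, k.+1, l, j; split; rewrite ?exprS //; ring.
have [ltj1|] := ltnP j.+1 (p ^ 3).
  by apply: lin_span_base; exists a, k, l, j.+1; split; rewrite ?exprS //; ring.
move=> gej; have {gej}Dj : j.+1 = (p ^ 3)%N by apply/eqP; rewrite eqn_leq ltj gej.
have -> : z * (x ^+ a * y ^+ k * Nz ^+ l * z ^+ j) = x ^+ a * y ^+ k * Nz ^+ l.+1
    + (- 1) *: (x ^+ a * y ^+ k * Nz ^+ l * (Nz - z ^+ (p ^ 3))).
  by rewrite -Dj exprS exprS scaleN1r; ring.
apply: lin_spanD.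
  by apply: lin_span_base; exists a, k, l.+1, 0%N; rewrite expn_gt0 p_gt0 expr0 mulr1.
apply: lin_spanZ; have := norm_z_tail (enum {: 'rV['Z_p]_3}).
rewrite -norm_zE // -cardE card_G; apply: lin_span_mull => _ [a' [k' [j' [ltj' ->]]]].
apply: lin_span_base; exists (a + a')%N, (k + k')%N, l, j'; split; rewrite ?exprD //; ring.
Qed.

(** If the exponent of delta reaches p, [deltaXp] applies: f1 has the weight p of delta^p, and the
    other terms have weight at most 1. *)
Lemma delta_reducedS d f : delta_reduced d f -> lin_span (delta_reduced d.+1) (delta * f).
Proof.
case=> a [i [l [m [j [ltj le ->]]]]]; have [ltj1|gej] := ltnP j.+1 p.
  by apply: lin_span_base; exists a, i, l, m, j.+1; split=> //; rewrite exprS; ring.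
have Dj : j.+1 = p by apply/eqP; rewrite eqn_leq ltj gej.
have -> : delta * (x ^+ a * y ^+ i * Nz ^+ l * f1 ^+ m * delta ^+ j) =
    (x ^+ a * y ^+ i * Nz ^+ l * f1 ^+ m) * delta ^+ p by rewrite -Dj exprS; ring.
have [c1 [c2 [c3 [c4 ->]]]] := deltaXp; rewrite 3!mulrDr -!scalerAr.
apply: lin_spanD; [apply: lin_spanD; [apply: lin_spanD|]|]; apply/lin_spanZ/lin_span_base.
- by exists a, i, l, m.+1, 0%N; split; rewrite ?mulnS ?exprS; [lia|lia|rewrite expr0; ring].
- by exists (a + p)%N, (i + p)%N, l, m, 0%N; split; [lia|lia|rewrite expr0 !exprD; ring].
- by exists (a + (2 * p - 2))%N, i, l, m, 1%N; split; [lia|lia|rewrite expr1 (exprD x); ring].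
by exists (a + (2 * p - 1))%N, i.+1, l, m, 0%N; split; [lia|lia|rewrite expr0 exprS !exprD; ring].
Qed.

Lemma xzX_delta_reduced k : lin_span (delta_reduced k) ((x * z) ^+ k).
Proof.
elim: k => [|k IH].
  by apply: lin_span_base; exists 0%N, 0%N, 0%N, 0%N, 0%N; rewrite !expr0 !mulr1 muln0.
rewrite exprS (_ : x * z = y ^+ 2 - delta) in IH *; last by rewrite /Defs.delta; ring.
rewrite mulrBl; apply: lin_spanD; last first.
  by rewrite -scaleN1r; apply: lin_spanZ; apply: lin_span_mull IH; apply: delta_reducedS.
apply: lin_span_mull IH => _ [a [i [l [m [j [ltj le ->]]]]]]; apply: lin_span_base.
by exists a, i.+2, l, m, j; split=> //; [apply: leqW|rewrite !(exprS y) expr0; ring].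
Qed.

Lemma delta_reduced_full f : lin_span (delta_reduced (p ^ 3).-1) (x ^+ (p ^ 3) * f).
Proof.
apply: lin_span_mull (z_reduced_full f) => _ [a [i [l [j [ltj ->]]]]].
(* Of the p^3 factors x, j are paired with the factors z. *)
have -> : x ^+ (p ^ 3) * (x ^+ a * y ^+ i * Nz ^+ l * z ^+ j) =
    (x ^+ (a + (p ^ 3 - j)) * y ^+ i * Nz ^+ l) * (x * z) ^+ j.
  by rewrite exprMn -[in LHS](subnK (ltnW ltj)) !exprD; ring.
apply: lin_span_mull (xzX_delta_reduced j) => _ [a' [i' [l' [m' [j' [ltj' le ->]]]]]].
apply: lin_span_base; exists (a + (p ^ 3 - j) + a')%N, (i + i')%N, (l + l')%N, m', j'.
by split=> //; [apply: leq_trans le _; rewrite -ltnS prednK ?expn_gt0 ?p_gt0|rewrite !exprD; ring].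
Qed.

Lemma reduced_mul_y f : reduced f -> lin_span reduced (y * f).
Proof.
case=> q [i [j [Qq lti ltj ->]]]; have [lti1|gei] := ltnP i.+1 (p ^ 2).
  by apply: lin_span_base; exists q, i.+1, j; split=> //; rewrite exprS; ring.
have Di : i.+1 = (p ^ 2)%N by apply/eqP; rewrite eqn_leq lti gei.
have -> : y * (q * y ^+ i * delta ^+ j) = q * delta ^+ j * y ^+ (p ^ 2) by rewrite -Di exprS; ring.
have [c1 [c2 ->]] := yXpp; rewrite !mulrDr -!scalerAr.
have ltp : (p < p ^ 2)%N by rewrite -{1}(expn1 p) ltn_exp2l ?prime_gt1.
case: Qq => a [n [l [m [ltm ->]]]].
apply: lin_spanD; [apply: lin_spanD|]; first apply: lin_span_base.
- exists (x ^+ a * N ^+ n.+1 * Nz ^+ l * f1 ^+ m), 0%N, j; split; rewrite ?expn_gt0 ?p_gt0 //.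
    by exists a, n.+1, l, m.
  by rewrite exprS expr0; ring.
- apply/lin_spanZ/lin_span_base.
  exists (x ^+ (a + (p ^ 2 - p)) * N ^+ n * Nz ^+ l * f1 ^+ m), p, j; split=> //.
    by exists (a + (p ^ 2 - p))%N, n, l, m.
  by rewrite exprD; ring.
apply/lin_spanZ/lin_span_base.
exists (x ^+ (a + (p ^ 2 - 1)) * N ^+ n * Nz ^+ l * f1 ^+ m), 1%N, j; split=> //.
- by exists (a + (p ^ 2 - 1))%N, n, l, m.
- exact: leq_ltn_trans p_gt0 ltp.
by rewrite exprD expr1; ring.
Qed.

Lemma reduced_full f : lin_span reduced (x ^+ (p ^ 3) * f).
Proof.
apply: lin_span_sub (delta_reduced_full f) => _ [a [i [l [m [j [ltj le ->]]]]]].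
(* The weight bound gives p m < p^3. *)
have ltm : (m < p ^ 2)%N.
  rewrite -(ltn_pmul2l p_gt0) -expnS; apply: leq_trans (_ : (p ^ 3).-1.+1 <= _)%N.
    by rewrite ltnS; apply: leq_trans le; apply: leq_addl.
  by rewrite prednK ?expn_gt0 ?p_gt0.
elim: i => [|i IH].
  apply: lin_span_base; exists (x ^+ a * N ^+ 0 * Nz ^+ l * f1 ^+ m), 0%N, j.
  by split; rewrite ?expn_gt0 ?p_gt0 ?expr0 ?mulr1 //; exists a, 0%N, l, m; rewrite expr0 mulr1.
have -> : x ^+ a * y ^+ i.+1 * Nz ^+ l * f1 ^+ m * delta ^+ j =
   y * (x ^+ a * y ^+ i * Nz ^+ l * f1 ^+ m * delta ^+ j) by rewrite exprS; ring.
apply: lin_span_mull IH; apply: reduced_mul_y.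
Qed.

Lemma reduced_coefs f : lin_span reduced f -> exists C : nat -> nat -> {mpoly F[3]},
  (forall i j, lin_span coef_reduced (C i j)) /\
  f = \sum_(i < p ^ 2) \sum_(j < p) C i j * y ^+ i * delta ^+ j.
Proof.
elim=> [|c _ g [q [i0 [j0 [Qq lti ltj ->]]]] _ [C [QC gE]]].
  exists (fun _ _ => 0); split=> [i j|]; first exact: span_zero.
  by rewrite big1 // => i _; rewrite big1 // => j _; rewrite !mul0r.
exists (fun i j => (if (i == i0) && (j == j0) then c *: q else 0) + C i j); split.
  move=> i j; apply: lin_spanD => //.
  by case: ifP => _; [apply/lin_spanZ/lin_span_base|apply: span_zero].
have -> : c *: (q * y ^+ i0 * delta ^+ j0) = \sum_(i < p ^ 2) \sum_(j < p)
    (if (i == i0 :> nat) && (j == j0 :> nat) then c *: q else 0) * y ^+ i * delta ^+ j.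
  rewrite (bigD1 (Ordinal lti)) //= [X in _ + X]big1 ?addr0 => [|i ne]; last first.
    by rewrite big1 // => j _; rewrite (_ : (i == i0 :> nat) = false) ?mul0r //; apply: negPf.
  rewrite (bigD1 (Ordinal ltj)) //= [X in _ + X]big1 ?addr0 => [|j ne]; last first.
    by rewrite (_ : (j == j0 :> nat) = false) ?andbF ?mul0r //; apply: negPf.
  by rewrite !eqxx /= -!scalerAl.
rewrite gE -big_split; apply: eq_bigr => i _; rewrite -big_split; apply: eq_bigr => j _.
by rewrite /= !mulrDl.
Qed.

Lemma coef_reduced_invariant f : lin_span coef_reduced f -> invariant_G p M f.
Proof.
move=> + v; rewrite act_GE; elim=> [|c _ g [a [n [l [m [_ ->]]]]] _ IH]; first by rewrite rmorph0.
rewrite comp_mpolyD comp_mpolyZ IH !rmorphM !rmorphXn /= shift_x.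
have invN g' : invariant_G p M (norm_G p M g') by apply: invariant_norm_G.
by rewrite !invariant_shift //; apply: invariant_f1.
Qed.

Lemma invariant_coef_reduced f :
  invariant_G p M f -> lin_span coef_reduced (x ^+ (p ^ 3) * f).
Proof.
move=> inv; have := reduced_full f.
move=> /reduced_coefs[C [QC E]]; set g := x ^+ (p ^ 3) * f in E *.
have [u al_u be_u] := alpha_kernel.
suff <- : C 0%N 0%N = g by [].
apply: (@interpolation_const _ (p ^ 2) p C g [seq y + al *: x | al <- alphas]) => //.
- by rewrite expn_gt0 p_gt0.
- rewrite map_inj_uniq ?undup_uniq // => al al' /addrI /eqP.
  by rewrite -subr_eq0 -scalerBl scaler_eq0 (negPf x_neq0) orbF subr_eq0 => /eqP.
- by rewrite size_map size_alphas.
move=> _ /mapP[_ /alphasP[v ->] ->].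
(* The p nodes over [alpha v] come from adding multiples of the kernel element u to v. *)
exists [seq delta - (beta v + beta u *+ t) *: x ^+ 2 | t <- iota 0 p].
  split; last by rewrite size_map size_iota.
  rewrite map_inj_in_uniq ?iota_uniq // => t t'; rewrite !mem_iota !add0n /= => ltt ltt'.
  move/addrI/oppr_inj/eqP; rewrite -subr_eq0 -scalerBl scaler_eq0 expf_eq0 (negPf x_neq0).
  rewrite andbF orbF.
  rewrite subr_eq0 => /eqP/addrI/eqP; rewrite -!(mulr_natl (beta u)) -subr_eq0 -mulrBl.
  rewrite mulf_eq0 (negPf be_u) orbF.
  by rewrite subr_eq0 => /eqP; apply: (natr_inj_pchar charF).
move=> _ /mapP[t _ ->].
have al_vu : alpha (v + u *+ t) = alpha v.
  by rewrite alphaD // (alphaMn u) al_u mul0rn addr0.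
have be_vu : beta (v + u *+ t) = beta v + beta u *+ t by rewrite betaD // (betaMn u).
have inv_g : invariant_G p M g.
  by move=> w; rewrite /g act_GE rmorphM /= shift_xX invariant_shift.
(* The element v + t u fixes g and the coefficients of its expansion, and moves y and delta to the
   chosen nodes. *)
rewrite -(invariant_shift (v + u *+ t) inv_g) E rmorph_sum; apply: eq_bigr => i _.
rewrite rmorph_sum; apply: eq_bigr => j _ /=.
rewrite !rmorphM !rmorphXn /= shift_y shift_delta al_vu -be_vu -al_vu.
by rewrite invariant_shift //; apply: coef_reduced_invariant.
Qed.

(* The normal products of generators are a basis of the invariants over F; that
   is, the invariants are a free module over F[x, N, Nz] with basis the
   f1^i (f3/x)^j, i, j < p. *)
Definition normal (K : 'X_{1..5}) := (K 1%R < p)%N && (K 3%R < p)%N.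

Local Notation b := (generators p M).

Lemma bprod_genE K : bprod b K =
  x ^+ K 0%R * f1 ^+ K 1%R * N ^+ K 2%R * f3x ^+ K 3%R * Nz ^+ K 4%R.
Proof. by rewrite /bprod comp_mpolyX prod_ord5 !(tnth_nth 0). Qed.

Lemma tnth_gen_neq0 i : tnth b i != 0.
Proof.
rewrite (tnth_nth 0); have [->|->|->|[->|->]] := ord5_cases i => //=.
- exact: has_lead_neq0 lead_f1.
- exact: has_lead_neq0 lead_norm_y.
- exact: has_lead_neq0 lead_f3x.
exact: has_lead_neq0 lead_norm_z.
Qed.

Local Notation lead K := (lead_mon (bprod b K)).

Lemma lead_genE K : lead K = (U_(0%R) *+ K 0%R
  + U_(1%R) *+ (2 * p * K 1%R + p ^ 2 * K 2%R + (p ^ 2 + 1) * K 3%R)%N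
  + U_(2%R) *+ (p ^ 3 * K 4%R)%N)%MM.
Proof.
rewrite bprod_genE.
have mulmA (m : 'X_{1..3}) k l : (m *+ k *+ l)%MM = (m *+ (k * l)%N)%MM.
  by apply/mnmP => i; rewrite !mulmnE mulnA.
have h1 := has_lead_exp (K 1%R) lead_f1.
have h2 := has_lead_exp (K 2%R) lead_norm_y.
have h3 := has_lead_exp (K 3%R) lead_f3x.
have h4 := has_lead_exp (K 4%R) lead_norm_z.
have h0 := has_lead_exp (K 0%R) (has_leadX F (U_(0%R) : 'X_{1..3})).
rewrite (lead_monE (has_leadM (has_leadM (has_leadM (has_leadM h0 h1) h2) h3) h4)) !mulmA.
by apply/mnmP => i; rewrite !(mnmDE, mulmnE) !mnm1E; lia.
Qed.

(** The exponent of z gives K 4. That of y is K 3 modulo p, which gives K 3 < p; after division by p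
    the rest is 2 K 1 modulo p, which gives K 1 < p since 2 is invertible, and then K 2. The
    exponent of x gives K 0. *)
Lemma lead_gen_inj : {in normal &, injective (fun K => lead K)}.
Proof.
move=> K K' /andP[lt1 lt3] /andP[lt1' lt3']; rewrite /= !lead_genE => E.
have := congr1 (fun m : 'X_{1..3} => m 0%R) E.
have := congr1 (fun m : 'X_{1..3} => m 1%R) E.
have := congr1 (fun m : 'X_{1..3} => m 2%R) E.
rewrite !(mnmDE, mulmnE) !mnm1E /= !(mul0n, mul1n, addn0, add0n) => E2 E1 E0.
have E4 : K 4%R = K' 4%R by apply/eqP; rewrite -(eqn_pmul2l (_ : 0 < p ^ 3)%N) ?expn_gt0 ?p_gt0 ?E2.
have E3 : K 3%R = K' 3%R.
  have := congr1 (modn^~ p) E1; rewrite -mulnn.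
  have e k1 k2 k3 :
      (2 * p * k1 + p * p * k2 + (p * p + 1) * k3 = (2 * k1 + p * k2 + p * k3) * p + k3)%N by lia.
  by rewrite !e !modnMDl !modn_small.
have Em : (2 * K 1%R + p * K 2%R = 2 * K' 1%R + p * K' 2%R)%N.
  apply/eqP; rewrite -(eqn_pmul2l p_gt0); move: E1; rewrite E3 -mulnn => /addIn E1.
  by apply/eqP; move: E1; lia.
have E1' : K 1%R = K' 1%R.
  apply: (natr_inj_pchar charF) => //; apply: (mulfI (two_neq0 charF p_gt2)).
  have := congr1 (fun k => k%:R : F) Em.
  have e k1 k2 : (2 * k1 + p * k2)%:R = 2 * k1%:R :> F.
    by rewrite natrD !natrM (pcharf0 charF) mul0r addr0.
  by rewrite !e !mulNr => ->.
have E2' : K 2%R = K' 2%R.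
  by move: Em; rewrite E1' => /addnI/eqP; rewrite eqn_pmul2l // => /eqP.
apply/mnmP => i; have [->|->|->|[->|->]] := ord5_cases i => //.
Qed.

(* The lead monomial of a normal product not involving x is free of x, so no
   cancellation of these products can create a factor x. *)
Lemma normal_divx P g : {subset msupp P <= normal} -> P \mPo b = x * g ->
  exists2 Q, {subset msupp Q <= normal} & g = Q \mPo b.
Proof.
move=> nP E; pose m0 : 'X_{1..5} := U_(0%R)%MM.
pose P0 := \sum_(K <- msupp P | K 0%R == 0%N) P@_K *: 'X_[K].
pose P1 := \sum_(K <- msupp P | K 0%R != 0%N) P@_K *: 'X_[(K - m0)%MM].
have EP : P = P0 + 'X_0 * P1.
  rewrite {1}(mpolyE P) (bigID (fun K : 'X_{1..5} => K 0%R == 0%N)) /=; congr (_ + _).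
  rewrite /P1 mulr_sumr; apply: eq_bigr => K K0; rewrite -scalerAr -mpolyXD addmC submK //.
  by rewrite lep1mP.
have supp_sum (Q : pred 'X_{1..5}) (h : 'X_{1..5} -> 'X_{1..5}) K :
    K \in msupp (\sum_(L <- msupp P | Q L) P@_L *: 'X_[h L]) ->
    exists2 L, L \in msupp P & Q L /\ K = h L.
  move=> /msupp_sum_le/flattenP[s /mapP[L + ->]]; rewrite mem_filter => /andP[QL LP].
  by move=> /msuppZ_le; rewrite msuppX inE => /eqP->; exists L.
have nP0 : {subset msupp P0 <= normal}.
  move=> K KP0; have [L LP [_ ->]] := supp_sum (fun K => K 0%R == 0%N) id K KP0.
  exact: nP.
have nP1 : {subset msupp P1 <= normal}.
  move=> K KP1.
  have [L /nP nL [_ ->]] := supp_sum (fun K => K 0%R != 0%N) (fun K => K - m0)%MM K KP1.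
  by move: nL; rewrite -!topredE /= /normal !mnmBE !mnm1E !subn0.
have gE : P0 \mPo b = x * (g - (P1 \mPo b)).
  rewrite mulrBr -E EP comp_mpolyD rmorphM /= comp_mpolyXU.
  by rewrite /= addrK.
suff P00 : P0 = 0.
  exists P1 => //; apply/eqP; rewrite -subr_eq0; apply/eqP/(mulfI x_neq0).
  by rewrite -gE P00 comp_mpoly0 mulr0.
apply/eqP; apply: contraT => P0n0.
have [K KP0 hK] := normal_lead tnth_gen_neq0 lead_gen_inj nP0 P0n0.
have [L _ [/eqP L0 KL]] := supp_sum (fun K => K 0%R == 0%N) id K KP0.
have := has_lead_supp hK; rewrite gE mulrC (perm_mem (msuppMX _ _)) => /mapP[m _].
move/(congr1 (fun m : 'X_{1..3} => m 0%R)); rewrite lead_genE !(mnmDE, mulmnE) !mnm1E /=.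
by rewrite KL L0.
Qed.

(** * Normal forms of invariants *)

Definition normal_comb f := exists2 P, {subset msupp P <= normal} & f = P \mPo b.

Lemma normal_combD f g : normal_comb f -> normal_comb g -> normal_comb (f + g).
Proof.
move=> [P nP ->] [Q nQ ->]; exists (P + Q); last by rewrite comp_mpolyD.
by move=> K /msuppD_le; rewrite mem_cat => /orP[/nP|/nQ].
Qed.

Lemma normal_combZ c f : normal_comb f -> normal_comb (c *: f).
Proof.
by move=> [P nP ->]; exists (c *: P); [move=> K /msuppZ_le/nP|rewrite comp_mpolyZ].
Qed.

(** Replacing f1^p by [f1Xp] lowers i in every term, as (p+1)/2 < p, and never raises i + p j: a new
    factor f3/x costs p factors f1. The bound on i + p j forces j < p. *)
Lemma normal_comb_mon i j a n l : (i + p * j < p ^ 2)%N ->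
  normal_comb (x ^+ a * N ^+ n * Nz ^+ l * f1 ^+ i * f3x ^+ j).
Proof.
elim/ltn_ind: i j a n l => i IH j a n l lt.
have [lti|gei] := ltnP i p.
  have ltj : (j < p)%N by rewrite -(ltn_pmul2l p_gt0) mulnn; apply: leq_ltn_trans (leq_addl _ _) lt.
  pose K := [multinom [tuple a; i; n; j; l]]; exists 'X_[K].
    by move=> K'; rewrite msuppX inE => /eqP->; rewrite -topredE /= /normal !(mnm_nth 0%N) /= lti.
  by rewrite -/(bprod b K) bprod_genE !(mnm_nth 0%N) /=; ring.
have [c [d E]] := f1Xp.
have -> : x ^+ a * N ^+ n * Nz ^+ l * f1 ^+ i * f3x ^+ j =
    x ^+ a * N ^+ n * Nz ^+ l * f1 ^+ (i - p) * f3x ^+ j * f1 ^+ p.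
  by rewrite -{1}(subnK gei) exprD; ring.
have po := p_odd.
rewrite E 2!mulrDr -!scalerAr; apply: normal_combD; [apply: normal_combD|]; apply: normal_combZ.
- have := IH (i - p)%N _ j a (n + 2)%N l; rewrite exprD.
  rewrite (_ : _ * _ * _ * _ * _ = x ^+ a * N ^+ n * Nz ^+ l * f1 ^+ (i - p) * f3x ^+ j
    * N ^+ 2); last by ring.
  by apply; lia.
- have := IH (i - p + (p + 1) %/ 2)%N _ j (a + (p ^ 2 - p))%N n l; rewrite !exprD.
  set e := ((p + 1) %/ 2)%N.
  rewrite (_ : _ * _ * _ * _ * _ = x ^+ a * N ^+ n * Nz ^+ l * f1 ^+ (i - p) * f3x ^+ j
    * (x ^+ (p ^ 2 - p) * f1 ^+ e)); last by ring.
  by apply; rewrite /e; lia.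
have := IH (i - p)%N _ j.+1 (a + (p ^ 2 - 1))%N n l; rewrite exprD exprS.
rewrite (_ : _ * _ * _ * _ * _ = x ^+ a * N ^+ n * Nz ^+ l * f1 ^+ (i - p) * f3x ^+ j
  * (x ^+ (p ^ 2 - 1) * f3x)); last by ring.
by apply; rewrite ?mulnS; lia.
Qed.

(** Multiplied by x^(p^3), f has only terms with f1 to a power below p^2 and no f3/x, so
    [normal_comb_mon] applies; [normal_divx] then cancels the factors x one at a time. *)
Lemma invariant_normal f : invariant_G p M f -> normal_comb f.
Proof.
move=> inv; suff: normal_comb (x ^+ (p ^ 3) * f).
  elim: (p ^ 3)%N => [|k IH]; first by rewrite expr0 mul1r.
  case=> P nP; rewrite exprS -mulrA => /esym E; apply: IH.
  exact: (normal_divx nP E).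
have := invariant_coef_reduced inv.
elim=> [|c _ g [a [n [l [m [ltm ->]]]]] _ IH].
  by exists 0; rewrite ?comp_mpoly0 // => K; rewrite msupp0.
apply/normal_combD/IH/normal_combZ.
by have := @normal_comb_mon m 0 a n l; rewrite expr0 mulr1 muln0 addn0; apply.
Qed.

Lemma invariant_comp P : invariant_G p M (P \mPo b).
Proof.
move=> v; rewrite act_GE comp_mpolyA; congr comp_mpoly; apply/eq_from_tnth => i.
rewrite tnth_map; apply: invariant_shift; rewrite (tnth_nth 0).
have [->|->|->|[->|->]] := ord5_cases i => /=.
- by move=> w; rewrite act_GE shift_x.
- exact: invariant_f1.
- exact: invariant_norm_G.
- exact: invariant_f3x.
exact: invariant_norm_G.
Qed.

(** * Rewriting by the two relations *)

Lemma rewrite_step I J r K (Id : {mpoly F[5]} -> Prop) (mu : 'X_{1..5} -> nat) :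
  tete_a_tete_relation b I J r -> lead I = lead J -> (I <= K)%MM ->
  (forall u, Id (u * r)) -> (mu (K - I + J)%MM < mu K)%N ->
  exists c K' s, [/\ Id ('X_[K] - c *: 'X_[K'] - s), lead K' = lead K, (mu K' < mu K)%N
    & {in msupp s, forall K'', grevlex_lt (lead K'') (lead K)}].
Proof.
move=> rel lIJ leIK Idr lt_mu.
have b0 := tnth_gen_neq0.
have [_ [c [s [rE lts]]]] := tete_a_tete_relationP b0 rel.
exists c, (K - I + J)%MM, ('X_[K - I] * s); split; last first.
- move=> K''; rewrite mulrC (perm_mem (msuppMX _ _)) => /mapP[L /lts lt ->].
  by rewrite -{2}(submK leIK) !(lead_bprodD b0) grevlex_lt_add2l.
- exact: lt_mu.
- by rewrite (lead_bprodD b0) -lIJ -(lead_bprodD b0) submK.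
have <- : 'X_[K - I] * r = 'X_[K] - c *: 'X_[(K - I + J)] - 'X_[K - I] * s.
  by rewrite rE !mulrBr -scalerAr -!mpolyXD submK.
exact: Idr.
Qed.

End Representation.

Theorem theorem8p6 (p : nat) (F : fieldType) (M : 'M[F]_(2, 3))
    (p_gt2 : (2 < p)%N) (charF : p \in [pchar F])
    (gamma123 : gamma p M 1 2 3 != 0) (gamma135 : gamma p M 1 3 5 = 0) :
  let b := generators p M in
  (* exponent vectors of (f3/x)^p, f1^((p^2+1)/2), f1^p and N_G(y)^2 *)
  let I1 : 'X_{1..5} := (U_(3%R : 'I_5) *+ p)%MM in
  let J1 : 'X_{1..5} := (U_(1%R : 'I_5) *+ ((p ^ 2 + 1) %/ 2))%MM in
  let I2 : 'X_{1..5} := (U_(1%R : 'I_5) *+ p)%MM in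
  let J2 : 'X_{1..5} := (U_(2%R : 'I_5) *+ 2)%MM in
  [/\ sagbi_basis (fun f => f \in (b : seq _)) (invariant_G p M),
      (exists r1, tete_a_tete_relation b I1 J1 r1),
      (exists r2, tete_a_tete_relation b I2 J2 r2)
    & forall r1 r2 : {mpoly F[5]},
        tete_a_tete_relation b I1 J1 r1 ->
        tete_a_tete_relation b I2 J2 r2 ->
        forall q : {mpoly F[5]},
          q \mPo b = 0 <-> exists u v, q = u * r1 + v * r2].
Proof.
move=> b I1 J1 I2 J2.
have b0 : forall i, tnth b i != 0 := tnth_gen_neq0 p_gt2 charF gamma123 gamma135.
have inj := lead_gen_inj p_gt2 charF gamma123 gamma135.
have invP := invariant_comp p_gt2 charF gamma123 gamma135.
have nfP := invariant_normal p_gt2 charF gamma123 gamma135.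
have [q0 Dp] : exists q0, p = (2 * q0 + 1)%N.
  by exists p./2; have := p_odd p_gt2 charF; lia.
have lE := lead_genE p_gt2 charF gamma123 gamma135.
have hE : (2 * ((p ^ 2 + 1) %/ 2) = p ^ 2 + 1)%N.
  have -> : (p ^ 2 = 2 * (q0 * p + q0) + 1)%N by rewrite -mulnn {1}Dp; lia.
  by lia.
have lIJ1 : lead_mon (bprod b I1) = lead_mon (bprod b J1).
  rewrite !lE; congr (_ + _ *+ _ + _)%MM; rewrite !mulmnE !mnm1E //=.
  rewrite !(mul0n, muln0, mul1n, add0n, addn0).
  by rewrite -mulnA [RHS]mulnCA hE mulnC.
have lIJ2 : lead_mon (bprod b I2) = lead_mon (bprod b J2).
  by rewrite !lE; congr (_ + _ *+ _ + _)%MM; rewrite !mulmnE !mnm1E //= -mulnn; lia.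
split.
- exact: (sagbi_of_normal b0 inj invP nfP).
- exact: (tete_a_tete_relation_exists b0 inj invP nfP lIJ1).
- exact: (tete_a_tete_relation_exists b0 inj invP nfP lIJ2).
move=> r1 r2 rel1 rel2 q; split; last first.
  case=> u [v ->]; rewrite comp_mpolyD !rmorphM /=.
  have [-> _] := tete_a_tete_relationP b0 rel1; have [-> _] := tete_a_tete_relationP b0 rel2.
  by rewrite !mulr0 addr0.
pose Id (q : {mpoly F[5]}) := exists u v, q = u * r1 + v * r2.
(* The first relation trades p factors f3/x for (p^2+1)/2 factors f1, the second trades p factors f1
   for N^2. The weight p^2 on f3/x makes both decrease [mu], as (p^2+1)/2 < p^3. *)
pose mu (K : 'X_{1..5}) := (p ^ 2 * K 3%R + K 1%R)%N.
have [||||P nP [u [v E]]] := @normal_form _ _ _ b (normal p) Id mu _ _ _ _ q.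
- by exists 0, 0; rewrite !mul0r addr0.
- by move=> _ _ [u [v ->]] [u' [v' ->]]; exists (u + u'), (v + v'); ring.
- by move=> c _ [u [v ->]]; exists (c *: u), (c *: v); rewrite scalerDr !scalerAl.
- move=> K; rewrite /normal negb_and -!leqNgt orbC => /orP[ge3|ge1].
    apply: (rewrite_step p_gt2 charF gamma123 gamma135 rel1) => //.
    + by apply/mnm_lepP => i; rewrite mulmnE mnm1E; case: eqP => [<-|_]; rewrite ?mul1n.
    + by move=> w; exists w, 0; rewrite mul0r addr0.
    rewrite /mu !(mnmDE, mnmBE, mulmnE) !mnm1E /= !mul1n !mul0n addn0 subn0.
    have lt_h : ((p ^ 2 + 1) %/ 2 < p ^ 2 * p)%N.
      have p0 : (0 < p ^ 2)%N by rewrite expn_gt0; lia.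
      by have : (p ^ 2 * 2 <= p ^ 2 * p)%N; [rewrite leq_mul2l (ltnW p_gt2) orbT|lia].
    by rewrite -{2}(subnK ge3) mulnDr; lia.
  apply: (rewrite_step p_gt2 charF gamma123 gamma135 rel2) => //.
  + by apply/mnm_lepP => i; rewrite mulmnE mnm1E; case: eqP => [<-|_]; rewrite ?mul1n.
  + by move=> w; exists 0, w; rewrite mul0r add0r.
  rewrite /mu !(mnmDE, mnmBE, mulmnE) !mnm1E /= !mul1n !mul0n !addn0 subn0.
  by rewrite -{2}(subnK ge1); lia.
(* Both relations vanish at the generators, hence so does the normal form P of q, and normal
   products are linearly independent. *)
move=> qb0; have P0 : P = 0.
  apply: (normal_neq0 b0 inj nP); move/(congr1 (comp_mpoly b)): E.
  rewrite comp_mpolyB qb0 comp_mpolyD !rmorphM /=.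
  have [-> _] := tete_a_tete_relationP b0 rel1; have [-> _] := tete_a_tete_relationP b0 rel2.
  by rewrite !mulr0 addr0 sub0r => /eqP; rewrite oppr_eq0 => /eqP.
by exists u, v; rewrite -E P0 subr0.
Qed.
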